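(* Let $n\geq 2$ be an integer, and let $R=\langle a,b\rangle$ be the finite $3$-group defined by the relations $$c=[a,b],\quad d=[b,a^2],\quad e=[a^2,b^2],\quad f=[b^2,a],\quad g=[c,e],\quad h=[d,f],$$ $$a^3=b^3=c^{3^n}=d^{3^n}=e^{3^n}=f^{3^n}=g^3=h^3=1,$$ $$[c,d]=c^{-3^{n-1}}d^{3^{n-1}},\quad [c,f]=c^{-3^{n-1}}f^{3^{n-1}},\quad [d,e]=d^{-3^{n-1}}e^{3^{n-1}},\quad [e,f]=e^{-3^{n-1}}f^{3^{n-1}},$$ $$[d^{3^{n-1}},c]=[d^{3^{n-1}},e]=[d^{3^{n-1}},f]=1,\quad [e^{3^{n-1}},c]=[e^{3^{n-1}},d]=[e^{3^{n-1}},f]=1,$$ $$f^{3^{n-1}}=c^{3^{n-1}}d^{-3^{n-1}}e^{3^{n-1}},\quad [c^{3^{n-1}},d]=[c^{3^{n-1}},e]=[c^{3^{n-1}},f]=1,$$ $$[g,a]=[g,b]=[h,a]=[h,b]=1,\quad h=c^{3^{n-1}}d^{3^{n-1}}e^{3^{n-1}},\quad g^{-1}=d^{3^{n-1}}e^{3^{n-1}}f^{3^{n-1}}.$$ Let $\Upsilon=\mathrm{Cay}(R,S)$ with $S=\{a,a^2,b,b^2\}$. Then $R$ has order $3^{4n+1}$, and $\Upsilon$ is a normal Cayley graph on $R$ with $\mathrm{Aut}(R,S)\cong C_4$. In particular, $\Upsilon$ is $3$-CSH but not $2$-geodesic-transitive, and the clique graph $C(\Upsilon)$ is a trivalent symmetric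 graph of type $2^2$.
   Context: Commutators are $[x,y]=x^{-1}y^{-1}xy$. For a finite group $G$ and an inverse-closed subset $S\subseteq G\setminus\{1\}$, $\mathrm{Cay}(G,S)$ has vertex set $G$ and edge set $\{\{g,sg\}\mid g\in G,\ s\in S\}$; $\mathrm{Aut}(G,S)=\{\alpha\in\mathrm{Aut}(G)\mid S^\alpha=S\}$; $R(G)$ denotes the group of right translations $x\mapsto xg$, a subgroup of $\mathrm{Aut}(\mathrm{Cay}(G,S))$; $\mathrm{Cay}(G,S)$ is a normal Cayley graph of $G$ if $R(G)$ is normal in $\mathrm{Aut}(\mathrm{Cay}(G,S))$. A graph is $3$-CSH ($3$-connected-set-homogeneous) if for every pair of isomorphic connected induced subgraphs on at most $3$ vertices there is an automorphism of the graph mapping the first to the second. A $2$-geodesic is a triple $(u,v,w)$ with $u$ adjacent to $v$, $v$ adjacent to $w$, and $u,w$ at distance $2$; a graph is $2$-geodesic-transitive if it has at least one $2$-geodesic and its automorphism group is transitive on arcs and on $2$-geodesics. The clique graph $C(\Gamma)$ has as vertices the maximal cliques (complete subgraphs not contained in larger ones) of $\Gamma$, with two different maximal cliques adjacent if they share at least one vertex. A symmetric graph is an arc-transitive graph. A trivalent (regular of valency $3$) symmetric graph $\Sigma$ is of type $2^2$ if $\mathrm{Aut}(\Sigma)_u\cong S_3$ and $\mathrm{Aut}(\Sigma)_{\{u,v\}}\cong C_4$ for an edge $\{u,v\}$, where $\mathrm{Aut}(\Sigma)_{\{u,v\}}$ is the setwise edge stabilizer. $C_4$ is the cyclic group of order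 $4$. *)

(* Defs.v *)
From HB Require Import structures.
From mathcomp Require Import all_boot all_fingroup zmodp.

Set Implicit Arguments.
Unset Strict Implicit.
Unset Printing Implicit Defensive.

Local Open Scope group_scope.

(** * The presentation *)

Definition relations (n : nat) (G : groupType) (a b : G) : Prop :=
  let c := [~ a, b] in
  let d := [~ b, a ^+ 2] in
  let e := [~ a ^+ 2, b ^+ 2] in
  let f := [~ b ^+ 2, a] in
  let g := [~ c, e] in
  let h := [~ d, f] in
  let q := (3 ^ n.-1)%N in
  [/\ [/\ a ^+ 3 = 1 & b ^+ 3 = 1],
      [/\ c ^+ (3 ^ n) = 1, d ^+ (3 ^ n) = 1, e ^+ (3 ^ n) = 1
        & f ^+ (3 ^ n) = 1],
      [/\ g ^+ 3 = 1 & h ^+ 3 = 1],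
      [/\ [~ c, d] = c ^- q * d ^+ q, [~ c, f] = c ^- q * f ^+ q,
          [~ d, e] = d ^- q * e ^+ q & [~ e, f] = e ^- q * f ^+ q]
    & [/\ [/\ [~ d ^+ q, c] = 1, [~ d ^+ q, e] = 1 & [~ d ^+ q, f] = 1],
          [/\ [~ e ^+ q, c] = 1, [~ e ^+ q, d] = 1 & [~ e ^+ q, f] = 1],
          f ^+ q = c ^+ q * d ^- q * e ^+ q /\
          [/\ [~ c ^+ q, d] = 1, [~ c ^+ q, e] = 1 & [~ c ^+ q, f] = 1],
          [/\ [~ g, a] = 1, [~ g, b] = 1, [~ h, a] = 1 & [~ h, b] = 1]
        & [/\ h = c ^+ q * d ^+ q * e ^+ q
            & g^-1 = d ^+ q * e ^+ q * f ^+ q]]].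

(* The finite group [R] with generators [a], [b] is the group presented by
   [relations n].  The universal property ranges over all groups, finite or not:
   [R \isog Grp (...)] would only say that [R] is the largest finite quotient of
   the presented group. *)
Definition presented (n : nat) (R : finGroupType) (a b : R) : Prop :=
  [/\ <<[set a; b]>> = [set: R],
      relations n a b
    & forall (H : groupType) (x y : H), relations n x y ->
        exists phi : {multiplicative R -> H}, phi a = x /\ phi b = y].

(** * Graphs

    A finite simple graph on [T] is an adjacency relation [adj : rel T], meant to
    be symmetric and irreflexive. *)

Section Graphs.
Variables (T : finType) (adj : rel T).

Definition graph_aut_set : {set {perm T}} :=
  [set p : {perm T} | [forall x, forall y, adj (p x) (p y) == adj x y]].

Lemma graph_aut_group_set : group_set graph_aut_set.
Proof.
apply/group_setP; split=> [|p q].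
  by rewrite inE; apply/forallP=> x; apply/forallP=> y; rewrite !perm1.
rewrite !inE => /forallP Hp /forallP Hq.
apply/forallP=> x; apply/forallP=> y; rewrite !permM.
by rewrite (eqP (forallP (Hq _) _)) (eqP (forallP (Hp _) _)).
Qed.

Definition graph_aut : {group {perm T}} := group graph_aut_group_set.

(* Connectedness and isomorphism of the subgraphs induced on vertex sets. *)
Definition induced_connected (A : {set T}) : Prop :=
  {in A &, forall x y, connect [rel u v | [&& u \in A, v \in A & adj u v]] x y}.

Definition induced_isomorphic (A B : {set T}) : Prop :=
  exists f : T -> T,
    [/\ {in A &, injective f}, f @: A = B
      & {in A &, forall x y, adj (f x) (f y) = adj x y}].

Definition CSH3 : Prop :=
  forall A B : {set T},
    #|A| <= 3 -> #|B| <= 3 ->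
    induced_connected A -> induced_connected B -> induced_isomorphic A B ->
    exists2 p : {perm T}, p \in graph_aut & p @: A = B.

Definition at_distance (k : nat) (u w : T) : Prop :=
  (exists p, [/\ path adj u p, last u p = w & size p = k]) /\
  (forall p, path adj u p -> last u p = w -> k <= size p).

Definition geodesic2 (u v w : T) : Prop :=
  [/\ adj u v, adj v w & at_distance 2 u w].

Definition arc_transitive : Prop :=
  forall u v u' v', adj u v -> adj u' v' ->
    exists2 p : {perm T}, p \in graph_aut & p u = u' /\ p v = v'.

Definition geodesic2_transitive : Prop :=
  [/\ exists u v w, geodesic2 u v w,
      arc_transitive
    & forall u v w u' v' w', geodesic2 u v w -> geodesic2 u' v' w' ->
        exists2 p : {perm T}, p \in graph_aut & [/\ p u = u', p v = v' & p w = w']].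

Definition trivalent : Prop := forall u, #|[set v | adj u v]| = 3.

Definition is_clique (A : {set T}) : bool :=
  [forall x in A, forall y in A, (x != y) ==> adj x y].

Definition max_clique : finType := {A : {set T} | maxset is_clique A}.

Definition clique_graph : rel max_clique :=
  [rel A B | (A != B) && (val A :&: val B != set0)].

End Graphs.

Arguments clique_graph {T} adj.

(* [ 'Z_4 ] is here the additive cyclic group of order 4. *)
Definition type2_2 (T : finType) (adj : rel T) : Prop :=
  exists u v, [/\ adj u v,
    'C_(graph_aut adj)[u | 'P] \isog [set: {perm 'I_3}]
  & 'N_(graph_aut adj)([set u; v] | 'P) \isog [set: 'Z_4]].

(** * Cayley graphs *)

Section Cayley.
Variables (G : finGroupType) (S : {set G}).

(* [h] is adjacent to [g] when [h = s * g] with [s \in S]; this is symmetric and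
   irreflexive when [connection_set] holds. *)
Definition cayley : rel G := [rel g h | h * g^-1 \in S].

Definition connection_set : Prop := 1 \notin S /\ S^-1 = S.

(* The action ['R] is right multiplication. *)
Definition right_translations : {set {perm G}} := actperm 'R @* [set: G].

Definition normal_cayley : Prop := right_translations <| graph_aut cayley.

Definition cayley_aut : {set {perm G}} := 'N_(Aut [set: G])(S | 'P).

End Cayley.

Lemma cayley_sym (G : finGroupType) (S : {set G}) :
  connection_set S -> symmetric (cayley S).
Proof.
by move=> [_ SV] x y; rewrite /cayley /= -[in LHS]SV inE invgM invgK.
Qed.

Lemma cayley_irr (G : finGroupType) (S : {set G}) :
  connection_set S -> irreflexive (cayley S).
Proof. by move=> [S1 _] x; rewrite /cayley /= mulgV (negbTE S1). Qed.

Lemma right_translationsE (G : finGroupType) :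
  right_translations G = [set perm (@mulIg G g) | g : G].
Proof.
have E g : actperm 'R g = perm (@mulIg G g).
  by apply/permP=> x; rewrite actpermE permE.
rewrite /right_translations morphimEdom; apply/setP=> p.
apply/imsetP/imsetP=> -[g _ ->]; exists g; rewrite //= E.
Qed.

Lemma cayley_autE (G : finGroupType) (S : {set G}) :
  cayley_aut S = [set p in Aut [set: G] | p @: S == S].
Proof.
apply/setP=> p; rewrite !inE /=; congr (_ && _).
apply/subsetP/eqP=> [sS | pS x Sx]; last by rewrite !inE -pS apermE imset_f.
apply/eqP; rewrite eqEcard (card_imset _ perm_inj) leqnn andbT.
by apply/subsetP=> _ /imsetP[x /sS Sx ->]; rewrite inE in Sx.
Qed.

(* Main.v *)
Require Import Defs.
From HB Require Import structures.
From mathcomp Require Import all_boot all_fingroup all_algebra all_solvable zmodp.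
From mathcomp Require Import integral_char.
From mathcomp Require Import ring zify.
Set Implicit Arguments.
Unset Strict Implicit.
Unset Printing Implicit Defensive.
Import GRing.Theory.
Local Open Scope group_scope.

(** Let [q = 3^(n-1)] and let [c], [d], [e], [f] be the commutators of the presentation.

    The group.  Conjugation by [a] or [b] carries these four commutators to products of
    them and of their inverses, so they generate the derived subgroup, and the relations
    amount to one law, [[x, y] = x^-q y^q], with central [q]-th powers subject to
    [f^q = c^q d^-q e^q] ([relationsP]).  Hence every element has a normal form
    [a^i b^j c^k d^l e^m f^t] with [i, j < 3], [k, l, m < 3^n] and [t < q], and the order
    is at most [3^(4n+1)].  For the converse, the law [[x, y] = x^-q y^q] is that of a
    group of class 2 attached by the Baer correspondence to a Lie ring on
    [(Z/3^n)^4], on which [a] and [b] act linearly; letting [a] and [b] multiply normal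
    forms on the right gives permutations that satisfy the relations modulo a central
    subgroup of order 3, and the quotient has the right order ([card_model]).  A group of
    that order satisfying the relations has the universal property: in its product with
    another such group, the pairs of generators again have at most [3^(4n+1)] normal
    forms, so that they generate the graph of a homomorphism ([presented_of_card]).

    The uniform law is invariant under the shift [a, b, a^2, b^2], which therefore extends
    to an automorphism [rot] of order 4; it is not invariant under the reflection fixing
    [a] and inverting [b] ([presented_no_reflection]).

    The graph.  Its triangles are the right cosets of [<a>] and of [<b>], each vertex lying
    in one of each family, so an automorphism keeps or exchanges the two families
    ([aut_type]).  In the group [G] of those that keep them, vertex stabilisers are
    2-groups, so [|G| = 2^i 3^j] and [G] is solvable by Burnside's theorem.  The main
    step is that the Sylow 3-subgroup of translations is [O_3(G)]
    ([pcore3_generated]): otherwise [O_3(G)] contains neither of the translations by [a]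
    and [b], which [rot] exchanges, and some normal subgroup [K] of [G], an extension of
    [O_3(G)] by a nontrivial 2-group, meets the stabilisers of the vertex 1 and of its two
    triangles in the same subgroup; the latter is then normalised by all translations, hence
    trivial, although it is a Sylow 2-subgroup of [K].  Automorphisms fixing 1 thus come
    from automorphisms of the group, and the absence of reflections leaves the powers of
    [rot] only ([aut_decomp]).

    The remaining assertions are read off from this description of the automorphism
    group.  For the clique graph, the edges correspond to the vertices of the Cayley graph,
    two of which are adjacent when the edges share an end, so that both graphs have the
    same automorphism group ([theta_onto], [theta_inj]). *)

Section GroupIdentities.
Variable G : groupType.
Implicit Types a b x y z : G.

Lemma commMg_conj x y z : [~ x * y, z] = [~ x, z] ^ y * [~ y, z].
Proof. by rewrite !commgEl !conjgE !gnorm. Qed.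

Lemma commgM_conj x y z : [~ x, y * z] = [~ x, z] * [~ x, y] ^ z.
Proof. by rewrite !commgEr !conjgE !gnorm. Qed.

Lemma sqr_cube1 a : a ^+ 3 = 1 -> a ^+ 2 = a^-1.
Proof. by move=> a3; apply: (mulIg a); rewrite -expgSr a3 mulVg. Qed.

Lemma sqr_sqr_cube1 a : a ^+ 3 = 1 -> (a ^+ 2) ^+ 2 = a.
Proof. by move=> a3; rewrite -expgnA (expgnDr a 3 1) a3 mul1g. Qed.

(** By [[z * a, x] = [z, x]^a * [a, x]], conjugation by [a] turns [[a^i, x]] into
    [[a^(i+1), x] * [a, x]^-1], and the exponents of [a] count modulo 3.  Hence the
    subgroup generated by the four commutators is stable under [a]. *)
Lemma conj_basic_comms a b : a ^+ 3 = 1 ->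
  [/\ [~ a, b] ^ a = [~ b, a ^+ 2]^-1 * [~ a, b]^-1,
      [~ b, a ^+ 2] ^ a = [~ a, b],
      [~ a ^+ 2, b ^+ 2] ^ a = [~ b ^+ 2, a]
    & [~ b ^+ 2, a] ^ a = [~ b ^+ 2, a]^-1 * [~ a ^+ 2, b ^+ 2]^-1].
Proof.
move=> a3.
have step1 x : [~ a, x] ^ a = [~ a ^+ 2, x] * [~ a, x]^-1.
  by rewrite expg2 commMg_conj mulgK.
have step2 x : [~ a ^+ 2, x] ^ a = [~ a, x]^-1.
  apply: (mulIg [~ a, x]); rewrite mulVg -commMg_conj -expgSr a3.
  by rewrite comm1g.
rewrite -(invgR a (b ^+ 2)) -(invgR (a ^+ 2) b) !conjVg !step1 !step2.
by rewrite !invgK; split=> //; rewrite invMg invgK.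
Qed.

(** If [[y, x] = y^-q x^q] with central [q]-th powers of exponent 3, powers of [y]
    move past [x] at the cost of [q]-th powers only. *)
Lemma expg_mul_swap q x y t :
  [~ y, x] = y ^- q * x ^+ q -> commute (x ^+ q) y -> (y ^+ q) ^+ 3 = 1 ->
  y ^+ t * x = x ^+ (1 + q * t) * y ^+ (t + 2 * (q * t)).
Proof.
move=> Ryx xq_y yq3; elim: t => [|t IHt]; first by rewrite !muln0 addn0 mulg1 mul1g.
have xqy s : commute (x ^+ q) (y ^+ s) by apply: commuteX.
have yx : y * x = x * x ^+ q * y ^+ (1 + 2 * q).
  rewrite commgC Ryx -(sqr_cube1 yq3) -expgnA (mulnC q) -!mulgA; congr (_ * _).
  by rewrite mulgA -expgS -add1n (xqy _).
have yxq s : commute (y ^+ s) (x ^+ (q * t)).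
  by rewrite expgnA; apply/commuteX/commute_sym/commuteX.
rewrite expgS -mulgA IHt expgnDr expg1 2!mulgA yx -!mulgA.
rewrite (mulgA (y ^+ _)) yxq -mulgA -expgnDr !mulgA; congr (_ * _).
  by rewrite mulnS addnA !expgnDr expg1.
by congr (_ ^+ _); rewrite mulnS mulnDr addnACA addnA.
Qed.

End GroupIdentities.

(** * A uniform form of the relations *)

(** Monomials in three commuting elements of exponent 3; equations between products
    of their powers reduce to arithmetic of exponents modulo 3. *)
Section CommutingCubes.
Variables (G : groupType) (x y z : G).
Hypotheses (xy : commute x y) (xz : commute x z) (yz : commute y z).
Hypotheses (x3 : x ^+ 3 = 1) (y3 : y ^+ 3 = 1) (z3 : z ^+ 3 = 1).

Definition monomial i j k := x ^+ i * y ^+ j * z ^+ k.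

Lemma monomialM i j k i' j' k' :
  monomial i j k * monomial i' j' k' = monomial (i + i') (j + j') (k + k').
Proof.
have xyX u v : commute (x ^+ u) (y ^+ v) by apply: commuteX2.
have xzX u v : commute (x ^+ u) (z ^+ v) by apply: commuteX2.
have yzX u v : commute (y ^+ u) (z ^+ v) by apply: commuteX2.
rewrite /monomial !expgnDr -!mulgA; congr (_ * _).
rewrite (mulgA (z ^+ k)) -(xzX i' k) -!mulgA (mulgA (y ^+ j)) -(xyX i' j) -!mulgA.
by congr (_ * (_ * _)); rewrite !mulgA (yzX j' k).
Qed.

Lemma monomial_mod i j k : monomial i j k = monomial (i %% 3) (j %% 3) (k %% 3).
Proof.
have red w m : w ^+ 3 = 1 -> w ^+ m = w ^+ (m %% 3) :> G.
  by move=> w3; rewrite {1}(divn_eq m 3) expgnDr mulnC expgnA w3 expg1n mul1g.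
by rewrite /monomial (red x) // (red y) // (red z).
Qed.

Lemma monomialV i j k : (monomial i j k)^-1 = monomial (2 * i) (2 * j) (2 * k).
Proof.
apply: mulg1_eq; rewrite monomialM monomial_mod.
by rewrite -!mulSn !modnMr /monomial !expg0 !mulg1.
Qed.

Lemma monomial100 : x = monomial 1%N 0%N 0%N.
Proof. by rewrite /monomial !expg0 !mulg1. Qed.

Lemma monomial010 : y = monomial 0%N 1%N 0%N.
Proof. by rewrite /monomial !expg0 mulg1 mul1g. Qed.

Lemma monomial001 : z = monomial 0%N 0%N 1%N.
Proof. by rewrite /monomial !expg0 !mul1g. Qed.

End CommutingCubes.

Section Relations.
Variable n : nat.
Hypothesis n_gt0 : 0 < n.
Let q := (3 ^ n.-1)%N.

Lemma expn3_pred : (3 ^ n = q * 3)%N.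
Proof. by rewrite -expnSr prednK. Qed.

Section OneGroup.
Variables (G : groupType) (a b : G).

Definition basic_comms : seq G :=
  [:: [~ a, b]; [~ b, a ^+ 2]; [~ a ^+ 2, b ^+ 2]; [~ b ^+ 2, a]].

(** In the group presented by [relations n] all the commutators of basic commutators
    obey one and the same law; this form of the relations is visibly invariant under
    the cyclic shift [a, b, a^2, b^2]. *)
Definition uniform_relations : Prop :=
  [/\ a ^+ 3 = 1 /\ b ^+ 3 = 1,
      {in basic_comms, forall x, x ^+ (3 ^ n) = 1},
      {in basic_comms &, forall x y, [~ x, y] = x ^- q * y ^+ q},
      {in basic_comms &, forall x y, commute (x ^+ q) y}
    & let c := [~ a, b] in let d := [~ b, a ^+ 2] in
      let e := [~ a ^+ 2, b ^+ 2] in let f := [~ b ^+ 2, a] in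
      f ^+ q = c ^+ q * d ^- q * e ^+ q /\
      [/\ commute [~ c, e] a, commute [~ c, e] b,
          commute [~ d, f] a & commute [~ d, f] b]].

Lemma basic_comms_ind (P : G -> Prop) :
  P [~ a, b] -> P [~ b, a ^+ 2] -> P [~ a ^+ 2, b ^+ 2] -> P [~ b ^+ 2, a] ->
  {in basic_comms, forall x, P x}.
Proof. by move=> Pc Pd Pe Pf x; rewrite !inE => /or4P[] /eqP->. Qed.

(** Everything takes place in the elementary abelian group generated by [c^q], [d^q]
    and [e^q].  Substituting the formula for [f^q] into those for [g] and [h] gives
    [[c, e] = c^-q e^q] and [[d, f] = d^-q f^q], the two laws that the presentation does
    not list; conversely these laws give back the formulas for [g] and [h]. *)
Lemma relationsP : relations n a b <-> uniform_relations.
Proof.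
rewrite /relations /uniform_relations -/q /=.
move: basic_comms_ind; rewrite /basic_comms.
set c := [~ a, b]; set d := [~ b, a ^+ 2].
set e := [~ a ^+ 2, b ^+ 2]; set f := [~ b ^+ 2, a] => ind.
have comm1 (x y : G) : [~ x, y] = 1 <-> commute x y.
  by split=> [/eqP/commgP | /commgP/eqP].
have cube x : x ^+ (3 ^ n) = 1 -> (x ^+ q) ^+ 3 = 1 :> G.
  by rewrite expn3_pred expgnA.
split.
- case=> -[a3 b3] [c1 d1 e1 f1] [g3 h3] [cd cf de ef].
  case=> -[/comm1 dc /comm1 de' /comm1 df] [/comm1 ec /comm1 ed /comm1 ef'] [fq].
  case=> [/comm1 cd' /comm1 ce /comm1 cf'] [/comm1 ga /comm1 gb /comm1 ha /comm1 hb].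
  case=> hE gE.
  have qC (x y : G) : commute x y -> commute x (y ^+ q) by apply: commuteX.
  pose z := monomial (c ^+ q) (d ^+ q) (e ^+ q).
  have zM := monomialM (qC _ _ cd') (qC _ _ ce) (qC _ _ de').
  have zV := monomialV (qC _ _ cd') (qC _ _ ce) (qC _ _ de')
                       (cube _ c1) (cube _ d1) (cube _ e1).
  have zm := monomial_mod (cube _ c1) (cube _ d1) (cube _ e1).
  have zc : c ^+ q = z 1%N 0%N 0%N := monomial100 _ _ _.
  have zd : d ^+ q = z 0%N 1%N 0%N := monomial010 _ _ _.
  have ze : e ^+ q = z 0%N 0%N 1%N := monomial001 _ _ _.
  have zf : f ^+ q = z 1%N 2%N 1%N by rewrite fq zc zd ze zV !zM.
  have ceE : [~ c, e] = c ^- q * e ^+ q.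
    apply: invg_inj; rewrite gE zf zd ze zc !(zV, zM).
    by rewrite [LHS]zm [RHS]zm.
  have dfE : [~ d, f] = d ^- q * f ^+ q.
    by rewrite hE zf zc zd ze !(zV, zM) [LHS]zm [RHS]zm.
  have fC (x : G) : commute (c ^+ q) x -> commute (d ^+ q) x -> commute (e ^+ q) x ->
      commute (f ^+ q) x.
    move=> cx dx ex; rewrite fq; apply/commute_sym; apply: commuteM; last first.
      exact: commute_sym.
    by apply: commuteM; [apply: commute_sym | apply/commuteV/commute_sym].
  have xx (x : G) : commute (x ^+ q) x by apply/commute_sym/commuteX.
  have swap (x y : G) : [~ x, y] = x ^- q * y ^+ q -> [~ y, x] = y ^- q * x ^+ q.
    by move=> E; rewrite -invgR E invMg invgK.
  have diag (x : G) : [~ x, x] = x ^- q * x ^+ q :> G by rewrite commgg mulVg.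
  split=> //; first exact: ind.
  + by move=> x y xs; move: x xs y; apply: (ind _); apply: (ind _) => //; apply: swap.
  + by move=> x y xs; move: x xs y; apply: (ind _); apply: (ind _) => //; apply: fC.
- case=> -[a3 b3] ord comm cent [fq [ga gb ha hb]].
  have sc : c \in [:: c; d; e; f] by rewrite !inE eqxx.
  have sd : d \in [:: c; d; e; f] by rewrite !inE eqxx ?orbT.
  have se : e \in [:: c; d; e; f] by rewrite !inE eqxx ?orbT.
  have sf : f \in [:: c; d; e; f] by rewrite !inE eqxx ?orbT.
  have qC x y : x \in [:: c; d; e; f] -> y \in [:: c; d; e; f] ->
    commute (x ^+ q) (y ^+ q) by move=> xs ys; apply: commuteX; apply: cent.
  have cub x : x \in [:: c; d; e; f] -> (x ^+ q) ^+ 3 = 1.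
    by move=> xs; apply/cube/ord.
  pose z := monomial (c ^+ q) (d ^+ q) (e ^+ q).
  have zM := monomialM (qC _ _ sc sd) (qC _ _ sc se) (qC _ _ sd se).
  have zV := monomialV (qC _ _ sc sd) (qC _ _ sc se) (qC _ _ sd se)
                       (cub _ sc) (cub _ sd) (cub _ se).
  have zm := monomial_mod (cub _ sc) (cub _ sd) (cub _ se).
  have zc : c ^+ q = z 1%N 0%N 0%N := monomial100 _ _ _.
  have zd : d ^+ q = z 0%N 1%N 0%N := monomial010 _ _ _.
  have ze : e ^+ q = z 0%N 0%N 1%N := monomial001 _ _ _.
  have zf : f ^+ q = z 1%N 2%N 1%N by rewrite fq zc zd ze zV !zM.
  have z0 : z 0%N 0%N 0%N = 1 by rewrite /z /monomial !mulg1.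
  have gz : [~ c, e] = z 2%N 0%N 1%N by rewrite comm // zc ze zV zM.
  have hz : [~ d, f] = z 1%N 4%N 1%N by rewrite comm // zd zf zV zM.
  have z3 i j k : z i j k ^+ 3 = 1.
    rewrite expgS expg2 !zM !addnn -!mul2n [LHS]zm -!mulSn.
    by rewrite !modnMr; exact: z0.
  split=> //; first by split; apply: ord.
  + by rewrite gz hz !z3.
  + by split; apply: comm.
  split; rewrite ?hz ?gz -?gz -?hz.
  + by split; apply/comm1/cent.
  + by split; apply/comm1/cent.
  + by split=> //; split; apply/comm1/cent.
  + by split; apply/comm1.
  + rewrite gz hz zf zc zd ze zV !zM; split; first by rewrite [LHS]zm.
    by rewrite [LHS]zm [RHS]zm.
Qed.

End OneGroup.

Lemma basic_comms_rot (G : groupType) (a b : G) : a ^+ 3 = 1 ->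
  basic_comms b (a ^+ 2) = seq.rot 1 (basic_comms a b).
Proof. by move=> a3; rewrite /basic_comms sqr_sqr_cube1. Qed.

Lemma relations_rot (G : groupType) (a b : G) :
  relations n a b -> relations n b (a ^+ 2).
Proof.
case/relationsP=> -[a3 b3] ord comm cent [fq [ga gb ha hb]].
have mem := mem_rot 1 (basic_comms a b).
have a32 : (a ^+ 2) ^+ 3 = 1 by rewrite expgnAC a3 expg1n.
have sub x : x \in basic_comms b (a ^+ 2) -> x \in basic_comms a b.
  by rewrite basic_comms_rot // mem_rot.
have qC x y : x \in basic_comms a b -> y \in basic_comms a b ->
  commute (x ^+ q) (y ^+ q) by move=> xs ys; apply: commuteX; apply: cent.
apply/relationsP; split=> //.
- by move=> x /sub; apply: ord.
- by move=> x y /sub xs /sub ys; apply: comm.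
- by move=> x y /sub xs /sub ys; apply: cent.
have sc : [~ a, b] \in basic_comms a b by rewrite !inE eqxx.
have sd : [~ b, a ^+ 2] \in basic_comms a b by rewrite !inE eqxx ?orbT.
have se : [~ a ^+ 2, b ^+ 2] \in basic_comms a b by rewrite !inE eqxx ?orbT.
have VC (x y : G) : commute x y -> commute x^-1 y.
  by move=> /commute_sym/commuteV/commute_sym.
rewrite /= sqr_sqr_cube1 // -(invgR [~ a, b]); split.
  have cde : commute ([~ a, b] ^+ q) ([~ b, a ^+ 2] ^+ q * [~ a ^+ 2, b ^+ 2] ^- q).
    by apply: commuteM; [apply: qC | apply/commuteV/qC].
  rewrite fq !mulgA -cde [[~ b, _] ^+ q * _]commuteV ?mulgA; last exact: qC.
  by rewrite mulgK mulgVK.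
split=> //; try apply: VC => //; exact: commuteX.
Qed.

End Relations.

(** * Normal forms *)

Section NormalForms.
Variable n : nat.
Hypothesis n_gt0 : 0 < n.
Let q := (3 ^ n.-1)%N.

Section OneGroup.
Variables (G : groupType) (a b : G).
Hypothesis rel_ab : relations n a b.
Let c := [~ a, b].
Let d := [~ b, a ^+ 2].
Let e := [~ a ^+ 2, b ^+ 2].
Let f := [~ b ^+ 2, a].

Let a3 : a ^+ 3 = 1. Proof. by case/(relationsP n_gt0): rel_ab => -[]. Qed.
Let b3 : b ^+ 3 = 1. Proof. by case/(relationsP n_gt0): rel_ab => -[]. Qed.

Let mem_c : c \in basic_comms a b. Proof. by rewrite !inE eqxx. Qed.
Let mem_d : d \in basic_comms a b. Proof. by rewrite !inE eqxx ?orbT. Qed.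
Let mem_e : e \in basic_comms a b. Proof. by rewrite !inE eqxx ?orbT. Qed.
Let mem_f : f \in basic_comms a b. Proof. by rewrite !inE eqxx ?orbT. Qed.

Lemma basic_comm_expn3 : {in basic_comms a b, forall x, x ^+ (3 ^ n) = 1}.
Proof. by case/(relationsP n_gt0): rel_ab. Qed.

Lemma basic_comm_swap : {in basic_comms a b &, forall x y l s,
  exists l' s', y ^+ l * x ^+ s = x ^+ s' * y ^+ l'}.
Proof.
case/(relationsP n_gt0): rel_ab => _ ord comm cent _ x y xs ys l.
have yq3 : (y ^+ q) ^+ 3 = 1 by rewrite -expgnA -expn3_pred // ord.
elim=> [|s [l' [s' IH]]]; first by exists l, 0; rewrite mulg1 mul1g.
exists (l' + 2 * (q * l')), (s' + (1 + q * l')).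
rewrite expgSr mulgA IH -mulgA (expg_mul_swap _ (comm _ _ ys xs)) //.
  by rewrite mulgA -expgnDr.
exact: cent.
Qed.

(** The subgroup generated by the basic commutators, described by its normal forms. *)
Definition comm_word (x : G) : Prop :=
  exists k l m t, x = c ^+ k * d ^+ l * e ^+ m * f ^+ t.

Lemma comm_word1 : comm_word 1.
Proof. by exists 0, 0, 0, 0; rewrite !mulg1. Qed.

(** The new factor travels to the left, through the powers that come after its own;
    each exchange changes exponents only. *)
Lemma comm_word_mulX x s p : x \in basic_comms a b ->
  comm_word p -> comm_word (p * x ^+ s).
Proof.
move=> xs [k [l [m [t ->]]]].
have: [\/ x = c, x = d, x = e | x = f].
  move: xs; rewrite !inE => /or4P[] /eqP->; by
    [apply: Or41 | apply: Or42 | apply: Or43 | apply: Or44].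
case=> ->; last by exists k, l, m, (t + s); rewrite expgnDr !mulgA.
- have [t1 [s1 E1]] := basic_comm_swap mem_c mem_f t s.
  have [m1 [s2 E2]] := basic_comm_swap mem_c mem_e m s1.
  have [l1 [s3 E3]] := basic_comm_swap mem_c mem_d l s2.
  exists (k + s3), l1, m1, t1.
  by rewrite -!mulgA E1 (mulgA (e ^+ m)) E2 !mulgA -(mulgA (c ^+ k)) E3 expgnDr !mulgA.
- have [t1 [s1 E1]] := basic_comm_swap mem_d mem_f t s.
  have [m1 [s2 E2]] := basic_comm_swap mem_d mem_e m s1.
  exists k, (l + s2), m1, t1.
  by rewrite -!mulgA E1 (mulgA (e ^+ m)) E2 expgnDr !mulgA.
- have [t1 [s1 E1]] := basic_comm_swap mem_e mem_f t s.
  by exists k, l, (m + s1), t1; rewrite -!mulgA E1 expgnDr !mulgA.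
Qed.

Lemma comm_wordM x y : comm_word x -> comm_word y -> comm_word (x * y).
Proof.
move=> xP [k [l [m [t ->]]]]; rewrite !mulgA.
by do 4!apply: comm_word_mulX => //.
Qed.

Lemma comm_wordX x s : comm_word x -> comm_word (x ^+ s).
Proof.
move=> xP; elim: s => [|s IH]; first exact: comm_word1.
by rewrite expgS; apply: comm_wordM.
Qed.

Lemma basic_comm_word x : x \in basic_comms a b -> comm_word x.
Proof.
by move=> xs; rewrite -[x]mul1g -[x]expg1; apply/comm_word_mulX/comm_word1.
Qed.

Lemma basic_comm_wordV x : x \in basic_comms a b -> comm_word x^-1.
Proof.
move=> xs; rewrite (_ : x^-1 = x ^+ (3 ^ n).-1).
  exact/comm_wordX/basic_comm_word.
apply: (mulIg x); rewrite mulVg -expgSr prednK ?expn_gt0 //.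
by rewrite basic_comm_expn3.
Qed.

Lemma comm_word_conj g : {in basic_comms a b, forall x, comm_word (x ^ g)} ->
  forall p, comm_word p -> comm_word (p ^ g).
Proof.
move=> gens p [k [l [m [t ->]]]]; rewrite !conjMg !conjXg.
by do 3?apply: comm_wordM; apply/comm_wordX/gens.
Qed.

Lemma comm_word_conja p : comm_word p -> comm_word (p ^ a).
Proof.
have [ca da ea fa] := conj_basic_comms b a3; apply: comm_word_conj.
apply: basic_comms_ind; rewrite ?ca ?da ?ea ?fa; try exact: basic_comm_word.
  by apply: comm_wordM; apply: basic_comm_wordV.
by apply: comm_wordM; apply: basic_comm_wordV.
Qed.

Lemma comm_word_conjb p : comm_word p -> comm_word (p ^ b).
Proof.
have [] := conj_basic_comms (a ^+ 2) b3; rewrite sqr_sqr_cube1 //.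
move=> db eb fb cb; apply: comm_word_conj.
apply: basic_comms_ind; rewrite ?cb ?db ?eb ?fb; try exact: basic_comm_word.
  by apply: comm_wordM; apply: basic_comm_wordV.
by apply: comm_wordM; apply: basic_comm_wordV.
Qed.

Lemma comm_word_commX j : comm_word [~ b ^+ j, a].
Proof.
rewrite (divn_eq j 3) expgnDr mulnC expgnA b3 expg1n mul1g.
have: j %% 3 < 3 by rewrite ltn_mod.
case: (j %% 3) => [|[|[|//]]] _; first by rewrite comm1g; apply: comm_word1.
  by rewrite -invgR; apply: basic_comm_wordV.
exact: basic_comm_word.
Qed.

Definition nf_index : finType :=
  ('I_3 * 'I_3 * ('I_(3 ^ n) * 'I_(3 ^ n) * 'I_(3 ^ n) * 'I_(3 ^ n.-1)))%type.

Definition normal_form (x : nf_index) : G :=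
  let: (i, j, (k, l, m, t)) := x in
  a ^+ i * b ^+ j * ([~ a, b] ^+ k * [~ b, a ^+ 2] ^+ l *
    [~ a ^+ 2, b ^+ 2] ^+ m * [~ b ^+ 2, a] ^+ t).

(** The relation between the [q]-th powers is what allows the exponent of the last
    commutator to be taken below [q] only. *)
Lemma normal_form_onto i j p :
  comm_word p -> exists x, a ^+ i * b ^+ j * p = normal_form x.
Proof.
case/(relationsP n_gt0): rel_ab => _ ord comm cent [fq _] [k [l [m [t ->]]]].
have q0 : 0 < q by rewrite expn_gt0.
have N0 : 0 < 3 ^ n by rewrite expn_gt0.
(* The power [f^(q * s)] is central and is absorbed by the other three factors. *)
pose s := t %/ q.
have red x N k' : 0 < N -> x ^+ N = 1 -> x ^+ k' = x ^+ (k' %% N) :> G.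
  by move=> _ x1; rewrite {1}(divn_eq k' N) expgnDr mulnC expgnA x1 expg1n mul1g.
have dq3 : (d ^+ q) ^+ 3 = 1 by rewrite -expgnA -expn3_pred // ord.
have qC x y u v : x \in basic_comms a b -> y \in basic_comms a b ->
    commute (x ^+ (q * u)) (y ^+ v).
  move=> xs ys; apply: commuteX; rewrite expgnA; apply/commute_sym/commuteX.
  exact/commute_sym/cent.
have fs : f ^+ (q * s) = c ^+ (q * s) * d ^+ (q * (2 * s)) * e ^+ (q * s).
  rewrite expgnA /f fq -(sqr_cube1 dq3) -expgnA -/c -/d -/e.
  have C1 : commute (c ^+ q) (d ^+ (q * 2)) by rewrite -[in c ^+ _](muln1 q); apply: qC.
  have C2 : commute (c ^+ q * d ^+ (q * 2)) (e ^+ q).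
    apply/commute_sym/commuteM.
      by rewrite -{1}[q](muln1 q); apply: qC.
    by rewrite -{1}[q](muln1 q); apply: qC.
  by rewrite (expgMn s C2) (expgMn s C1) -!expgnA mulnA.
have E : c ^+ k * d ^+ l * e ^+ m * f ^+ t =
    c ^+ (k + q * s) * d ^+ (l + q * (2 * s)) * e ^+ (m + q * s) * f ^+ (t %% q).
  rewrite {1}(divn_eq t q) expgnDr mulnC fs !expgnDr -!mulgA; congr (_ * _).
  rewrite (mulgA (e ^+ m)) -(qC c e) // (mulgA (d ^+ l)) [d ^+ l * _]mulgA.
  rewrite -(qC c d) // -!mulgA; congr (_ * (_ * _)).
  by rewrite (mulgA (e ^+ m)) -(qC d e) // -!mulgA.
rewrite E (red a 3 i) // (red b 3 j) // (red c (3 ^ n)%N) ?ord //.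
rewrite (red d (3 ^ n)%N) ?ord // (red e (3 ^ n)%N) ?ord //.
by exists (Ordinal (ltn_pmod i (isT : 0 < 3)), Ordinal (ltn_pmod j (isT : 0 < 3)),
  (Ordinal (ltn_pmod (k + q * s) N0), Ordinal (ltn_pmod (l + q * (2 * s)) N0),
   Ordinal (ltn_pmod (m + q * s) N0), Ordinal (ltn_pmod t q0))).
Qed.

Lemma normal_form_comm_word (x : nf_index) : exists i j p,
  comm_word p /\ normal_form x = a ^+ i * b ^+ j * p.
Proof.
case: x => -[i j] [[[k l] m] t]; exists i, j.
by eexists; split; last by []; exists k, l, m, t.
Qed.

Lemma normal_form_1 : exists x, 1 = normal_form x.
Proof.
have [x E] := normal_form_onto 0 0 comm_word1.
by exists x; rewrite -E !mulg1.
Qed.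

(** Normal forms are stable under right multiplication by both generators, so they
    exhaust every group that satisfies the relations. *)
Lemma normal_form_mula x : exists y, normal_form x * a = normal_form y.
Proof.
have [i [j [p [pP ->]]]] := normal_form_comm_word x.
have [y E] := normal_form_onto i.+1 j
  (comm_wordM (comm_word_commX j) (comm_word_conja pP)).
exists y; rewrite -E -!mulgA conjgE expgSr -!mulgA; congr (_ * _).
by rewrite !gnorm.
Qed.

Lemma normal_form_mulb x : exists y, normal_form x * b = normal_form y.
Proof.
have [i [j [p [pP ->]]]] := normal_form_comm_word x.
have [y E] := normal_form_onto i j.+1 (comm_word_conjb pP).
by exists y; rewrite -E conjgE expgSr !gnorm.
Qed.

End OneGroup.

Lemma card_nf_index : #|nf_index| = (3 ^ (4 * n + 1))%N.
Proof.
rewrite !card_prod !card_ord -(prednK n_gt0) /= -[in (3 * 3)%N](expn1 3) -!expnD.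
by congr (3 ^ _)%N; lia.
Qed.

End NormalForms.

(** * The universal property *)

Section Morph.
Variables (G H : groupType) (phi : G -> H).
Hypothesis phiM : {morph phi : x y / x * y}.

Lemma morph_group1 : phi 1 = 1.
Proof. by apply: (mulIg (phi 1)); rewrite -phiM !mul1g. Qed.

Lemma morph_groupV x : phi x^-1 = (phi x)^-1.
Proof. by apply/esym/mulg1_eq; rewrite -phiM mulgV morph_group1. Qed.

Lemma morph_groupX x m : phi (x ^+ m) = phi x ^+ m.
Proof. by elim: m => [|m IH]; rewrite ?morph_group1 // !expgS phiM IH. Qed.

Lemma morph_groupR x y : phi [~ x, y] = [~ phi x, phi y].
Proof. by rewrite !commgEl !conjgE !phiM !morph_groupV. Qed.

Definition morph_groupE :=
  (phiM, morph_groupR, morph_groupX, morph_groupV, morph_group1).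

End Morph.

(** This serves for the two projections of a product, and, with both maps equal, for
    an embedding. *)
Lemma relations_jointly_inj n (G H1 H2 : groupType) (p1 : G -> H1) (p2 : G -> H2)
    (p1M : {morph p1 : x y / x * y}) (p2M : {morph p2 : x y / x * y}) a b :
  (forall x y, p1 x = p1 y -> p2 x = p2 y -> x = y) ->
  relations n (p1 a) (p1 b) -> relations n (p2 a) (p2 b) -> relations n a b.
Proof.
move=> inj; rewrite /relations /=.
case=> -[? ?] [? ? ? ?] [? ?] [? ? ? ?] [[? ? ?] [? ? ?] [? [? ? ?]] [? ? ? ?] [? ?]].
case=> -[? ?] [? ? ? ?] [? ?] [? ? ? ?] [[? ? ?] [? ? ?] [? [? ? ?]] [? ? ? ?] [? ?]].
by do !split; apply: inj; rewrite !(morph_groupE p1M, morph_groupE p2M).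
Qed.

Lemma relations_inj n (G H : groupType) (p : G -> H)
    (pM : {morph p : x y / x * y}) a b :
  injective p -> relations n (p a) (p b) -> relations n a b.
Proof.
move=> inj rel; apply: (relations_jointly_inj pM pM) => // x y E _; exact: inj.
Qed.

Section Generation.
Variables (M : finGroupType) (a b : M).
Hypothesis gen_ab : <<[set a; b]>> = [set: M].

Lemma gen_indr (P : M -> Prop) :
  P 1 -> (forall x, P x -> P (x * a)) -> (forall x, P x -> P (x * b)) ->
  forall x, P x.
Proof.
move=> P1 Pa Pb x.
have /gen_prodgP[m [s sab ->]] : x \in <<[set a; b]>> by rewrite gen_ab inE.
elim: m s sab => [|m IH] s sab; first by rewrite big_ord0.
rewrite big_ord_recr /=; have {}IH := IH _ (fun i => sab (widen_ord (leqnSn m) i)).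
by have /set2P[] := sab ord_max => ->; [apply: Pa | apply: Pb].
Qed.

Lemma gen_indl (P : M -> Prop) :
  P 1 -> (forall x, P x -> P (a * x)) -> (forall x, P x -> P (b * x)) ->
  forall x, P x.
Proof.
move=> P1 Pa Pb x.
have /gen_prodgP[m [s sab ->]] : x \in <<[set a; b]>> by rewrite gen_ab inE.
elim: m s sab => [|m IH] s sab; first by rewrite big_ord0.
rewrite big_ord_recl /=; have {}IH := IH _ (fun i => sab (lift ord0 i)).
by have /set2P[] := sab ord0 => ->; [apply: Pa | apply: Pb].
Qed.

End Generation.

Section Universal.
Variable n : nat.
Hypothesis n_gt0 : 0 < n.

Lemma normal_form_surj (M : finGroupType) (a b : M) :
  <<[set a; b]>> = [set: M] -> relations n a b ->
  forall x, exists u : nf_index n, x = normal_form a b u.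
Proof.
move=> gen rel; apply: (gen_indr gen) => [|x [u ->]|x [u ->]].
- exact: normal_form_1.
- exact: normal_form_mula.
- exact: normal_form_mulb.
Qed.

Lemma normal_form_inj (M : finGroupType) (a b : M) :
  <<[set a; b]>> = [set: M] -> relations n a b -> 3 ^ (4 * n + 1) <= #|M| ->
  injective (@normal_form n _ a b) /\ #|M| = (3 ^ (4 * n + 1))%N.
Proof.
move=> gen rel leM; rewrite -card_nf_index // in leM *.
have imT : [set normal_form a b u | u : nf_index n] = setT.
  apply/setP=> x; rewrite inE; have [u ->] := normal_form_surj gen rel x.
  exact: imset_f.
have cM : #|M| = #|nf_index n|.
  apply/eqP; rewrite eqn_leq leM andbT -(cardsT M) -imT.
  exact: leq_imset_card.
have /imset_injP inj : #|[set normal_form a b u | u : nf_index n]| == #|nf_index n|.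
  by rewrite imT cardsT cM.
by split=> // u v E; apply: inj.
Qed.

(** A homomorphism out of [M] is read off the subgroup of [M * H] generated by
    [(a, x)] and [(b, y)]: this subgroup also satisfies the relations, so its elements
    are normal forms, and since [M] has as many elements as there are normal forms,
    the subgroup is the graph of a function. *)
Lemma presented_of_card (M : finGroupType) (a b : M) :
  <<[set a; b]>> = [set: M] -> relations n a b -> 3 ^ (4 * n + 1) <= #|M| ->
  presented n a b.
Proof.
move=> gen rel leM; split=> // H x y rel_xy.
have [nf_inj _] := normal_form_inj gen rel leM.
pose a' : M * H := (a, x); pose b' : M * H := (b, y).
have rel' : relations n a' b'.
  apply: (@relations_jointly_inj _ _ _ _ fst snd) => //.
  by move=> [? ?] [? ?] /= -> ->.
pose N := @normal_form n _ a' b'.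
have N1 u : (N u).1 = normal_form a b u.
  case: u => -[i j] [[[k l] m] t]; rewrite /N /normal_form.
  have fM : {morph (fst : M * H -> M) : u v / u * v} by [].
  by rewrite !(morph_groupE fM).
have N_ex z : exists u, (N u).1 == z.
  by have [u ->] := normal_form_surj gen rel z; exists u; rewrite N1.
pose phi z := (N (xchoose (N_ex z))).2.
have phiE u : phi (N u).1 = (N u).2.
  rewrite /phi; congr (N _).2; apply: nf_inj; rewrite -!N1.
  exact/eqP/(xchooseP (N_ex _)).
have NE z : exists2 u, (N u).1 = z & phi z = (N u).2.
  by have [u /eqP <-] := N_ex z; exists u.
have phi1 : phi 1 = 1.
  by have [u E] := normal_form_1 n_gt0 rel'; have := phiE u; rewrite /N -E.
have phia z : phi (z * a) = phi z * x.
  have [u <- ->] := NE z; have [v E] := normal_form_mula n_gt0 rel' u.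
  by have := phiE v; rewrite /N -E.
have phib z : phi (z * b) = phi z * y.
  have [u <- ->] := NE z; have [v E] := normal_form_mulb n_gt0 rel' u.
  by have := phiE v; rewrite /N -E.
have phiM : {morph phi : z w / z * w}.
  move=> z w; move: w z; apply: (gen_indr gen) => [z|w IH z|w IH z].
  - by rewrite phi1 !mulg1.
  - by rewrite mulgA !phia IH mulgA.
  - by rewrite mulgA !phib IH mulgA.
pose phi_mult : {multiplicative M -> H} := HB.pack phi (isMultiplicative.Build M H phi phiM).
exists phi_mult; rewrite /= -[a]mul1g -[b]mul1g.
by split; [rewrite phia phi1 mul1g | rewrite phib phi1 mul1g].
Qed.

End Universal.

(** * A model of the presented group *)

Ltac split_vec := repeat apply: (f_equal2 pair).

Section Model.
Variables (K : finComNzRingType) (q : K).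
Local Open Scope ring_scope.
Hypotheses (q2 : q ^+ 2 = 0) (q3 : 3 * q = 0).

(** The coordinate identities below are consequences of [q^2 = 0] and [3 * q = 0]; the
    witness [w] is the quotient of the difference of the two sides by [3 * q]. *)
Lemma eq_mod3q (w x y : K) : x = y + 3 * q * w -> x = y.
Proof. by rewrite q3 mul0r addr0. Qed.

Definition vec : finType := (K * K * K * K)%type.

Definition vsum (v : vec) : K := let: (k, l, m, t) := v in k + l + m + t.

(** The vector [(k, l, m, t)] stands for a product of powers of [c], [d], [e], [f].  The
    law comes from the Lie bracket [[v, w] = q * (vsum v * w - vsum w * v)] by the Baer
    correspondence [v + w + [v, w] / 2], where halving is a change of sign because
    [3 * q = 0]. *)
Definition vop (v w : vec) : vec :=
  let: (k, l, m, t) := v in let: (k', l', m', t') := w in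
  let h x x' := x + x' - q * (vsum v * x' - vsum w * x) in
  (h k k', h l l', h m m', h t t').

Definition vopp (v : vec) : vec := let: (k, l, m, t) := v in (- k, - l, - m, - t).

Definition vscale (x : K) (v : vec) : vec :=
  let: (k, l, m, t) := v in (x * k, x * l, x * m, x * t).

Definition vzero : vec := (0, 0, 0, 0).
Definition vc : vec := (1, 0, 0, 0).
Definition vd : vec := (0, 1, 0, 0).
Definition ve : vec := (0, 0, 1, 0).
Definition vf : vec := (0, 0, 0, 1).
(** The product [c^q d^-q e^q f^-q], which is trivial in the presented group but not in
    the group of vectors; keeping it makes all four coordinates range over [K]. *)
Definition vr : vec := (q, - q, q, - q).

(** The linear maps given on the basis by conjugation by [a] and by [b]; for instance
    [c] goes to [d^-1 * c^-1], which is [- c - d - q * (c - d)] for the law [vop]. *)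
Definition acta (v : vec) : vec :=
  let: (k, l, m, t) := v in
  (- k - q * k + l, - k + q * k, - t - q * t, m - t + q * t).

Definition actb (v : vec) : vec :=
  let: (k, l, m, t) := v in
  (- k + q * k + t, - l - q * l + m, - l + q * l, - k - q * k).

Lemma vopA : associative vop.
Proof.
move=> [[[k l] m] t] [[[k' l'] m'] t'] [[[k2 l2] m2] t2]; rewrite /vop /vsum.
split_vec; ring: q2.
Qed.

Lemma vopK v w : vop (vop v w) (vopp w) = v.
Proof.
move: v w => [[[k l] m] t] [[[k' l'] m'] t']; rewrite /vop /vsum /=.
split_vec; ring: q2.
Qed.

Lemma acta_vop v w : acta (vop v w) = vop (acta v) (acta w).
Proof.
move: v w => [[[v1 v2] v3] v4] [[[u1 u2] u3] u4]; rewrite /vop /vsum /acta.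
split_vec.
- apply: (@eq_mod3q (- (u2 * v1 + u4 * v1 - u1 * v2 - u1 * v4 - u4 * v2 + u2 * v4))).
  ring: q2.
- apply: (@eq_mod3q (- (u4 * v1 - u1 * v4))); ring: q2.
- apply: (@eq_mod3q (- (u1 * v4 - u4 * v1))); ring: q2.
- apply: (@eq_mod3q (u1 * v3 + u4 * v3 - u3 * v1 - u3 * v4 - u1 * v4 + u4 * v1)).
  ring: q2.
Qed.

Lemma actb_vop v w : actb (vop v w) = vop (actb v) (actb w).
Proof.
move: v w => [[[v1 v2] v3] v4] [[[u1 u2] u3] u4]; rewrite /vop /vsum /actb.
split_vec.
- apply: (@eq_mod3q (- (u2 * v1 + u4 * v1 - u1 * v2 - u1 * v4 - u2 * v4 + u4 * v2))).
  ring: q2.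
- apply: (@eq_mod3q (- (u1 * v2 + u3 * v2 - u2 * v1 - u2 * v3 - u1 * v3 + u3 * v1))).
  ring: q2.
- apply: (@eq_mod3q (- (u1 * v2 - u2 * v1))); ring: q2.
- apply: (@eq_mod3q (- (u2 * v1 - u1 * v2))); ring: q2.
Qed.

(** The point [(i, j, v)] stands for [a^i * b^j * v]. *)
Definition point : finType := ('I_3 * 'I_3 * vec)%type.

(** The commutator [[b^j, a]], by which [b^j * v * a] differs from [a * b^j * v^a]. *)
Definition cocycle (j : 'I_3) : vec :=
  if val j is j'.+1 then if j' is 0 then vopp vc else vf else vzero.

Definition movea (x : point) : point :=
  let: (i, j, v) := x in (ordS i, j, vop (cocycle j) (acta v)).

Definition moveb (x : point) : point :=
  let: (i, j, v) := x in (i, ordS j, actb v).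

Definition mover (w : vec) (x : point) : point :=
  let: (i, j, v) := x in (i, j, vop v w).

Lemma ordS3 (i : 'I_3) : ordS (ordS (ordS i)) = i.
Proof. by case: i => -[|[|[|//]]] ?; apply: val_inj. Qed.

Lemma movea3 x : movea (movea (movea x)) = x.
Proof.
case: x => -[i j] [[[v1 v2] v3] v4]; rewrite /movea ordS3; congr (_, _, _).
case: j => -[|[|[|//]]] j3; rewrite /vop /vsum /acta /=; split_vec.
- apply: (@eq_mod3q (- v1 + v2)); ring: q2.
- apply: (@eq_mod3q (- v1)); ring: q2.
- apply: (@eq_mod3q (v4)); ring: q2.
- apply: (@eq_mod3q (- v3 + v4)); ring: q2.
- apply: (@eq_mod3q (- v3)); ring: q2.
- apply: (@eq_mod3q (v4 - v3)); ring: q2.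
- apply: (@eq_mod3q (v4 + v3)); ring: q2.
- apply: (@eq_mod3q (- v3 + 2 * v4)); ring: q2.
- apply: (@eq_mod3q (- 2 * v1 + v2)); ring: q2.
- apply: (@eq_mod3q (- v1 - v2)); ring: q2.
- apply: (@eq_mod3q (- v1 + v2)); ring: q2.
- apply: (@eq_mod3q (v2)); ring: q2.
Qed.

Lemma moveb3 x : moveb (moveb (moveb x)) = x.
Proof.
case: x => -[i j] [[[v1 v2] v3] v4]; rewrite /moveb ordS3; congr (_, _, _).
rewrite /actb; split_vec.
- apply: (@eq_mod3q (v1 - v4)); ring: q2.
- apply: (@eq_mod3q (- v2 + v3)); ring: q2.
- apply: (@eq_mod3q (- v2)); ring: q2.
- apply: (@eq_mod3q v1); ring: q2.
Qed.

Lemma moveab x : moveb (movea x) = mover vc (movea (moveb x)).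
Proof.
case: x => -[i j] [[[v1 v2] v3] v4]; rewrite /movea /moveb /mover; congr (_, _, _).
case: j => -[|[|[|//]]] j3; rewrite /vop /vsum /acta /actb /=; split_vec.
- apply: (@eq_mod3q (2 * v1)); ring: q2.
- apply: (@eq_mod3q 0); ring: q2.
- apply: (@eq_mod3q (- 2 * v1)); ring: q2.
- apply: (@eq_mod3q 0); ring: q2.
- apply: (@eq_mod3q (- v4 + v3 + v1)); ring: q2.
- apply: (@eq_mod3q (v1 - v4)); ring: q2.
- apply: (@eq_mod3q (- v1)); ring: q2.
- apply: (@eq_mod3q (- v1)); ring: q2.
- apply: (@eq_mod3q v2); ring: q2.
- apply: (@eq_mod3q 0); ring: q2.
- apply: (@eq_mod3q (- 2 * v1)); ring: q2.
- apply: (@eq_mod3q 0); ring: q2.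
Qed.

End Model.

Section ModelGroup.
Variables (K : finComNzRingType) (n : nat).
Hypothesis n_gt0 : 0 < n.
Let q : K := (3 ^ n.-1)%:R%R.
Local Open Scope ring_scope.
Hypotheses (q2 : q ^+ 2 = 0) (q3 : 3 * q = 0).
Local Open Scope group_scope.

Let T := point K.
Let op := vop q.

Lemma movea_inj : injective (@movea K q).
Proof. exact: (can_inj (g := fun x => movea q (movea q x)) (movea3 q2 q3)). Qed.

Lemma moveb_inj : injective (@moveb K q).
Proof. exact: (can_inj (g := fun x => moveb q (moveb q x)) (moveb3 q2 q3)). Qed.

Lemma mover_inj w : injective (@mover K q w).
Proof.
apply: (can_inj (g := mover q (vopp w))) => -[[i j] v].
by rewrite /mover vopK.
Qed.

Definition perma : {perm T} := perm movea_inj.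
Definition permb : {perm T} := perm moveb_inj.
Definition permr w : {perm T} := perm (mover_inj (w := w)).

Lemma permrM v w : permr v * permr w = permr (op v w).
Proof.
by apply/permP=> -[[i j] u]; rewrite permM !permE /mover /op vopA.
Qed.

Lemma perma3 : perma ^+ 3 = 1.
Proof. by apply/permP=> x; rewrite !expgS expg0 mulg1 !permM !permE movea3. Qed.

Lemma permb3 : permb ^+ 3 = 1.
Proof. by apply/permP=> x; rewrite !expgS expg0 mulg1 !permM !permE moveb3. Qed.

Lemma comm_permab : [~ perma, permb] = permr (vc K).
Proof.
apply: (mulgI (permb * perma)); rewrite -commgC.
by apply/permP=> x; rewrite !permM !permE moveab.
Qed.

Lemma permrJa v : permr v ^ perma = permr (acta q v).
Proof.
rewrite conjgE; apply/eqP; rewrite eq_mulVg1 -eq_mulVg1.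
apply/eqP; apply: (mulgI perma); rewrite mulKVg; apply/permP=> -[[i j] u].
by rewrite !permM !permE /mover /movea acta_vop // vopA.
Qed.

Lemma permrJb v : permr v ^ permb = permr (actb q v).
Proof.
rewrite conjgE; apply: (mulgI permb); rewrite mulKVg; apply/permP=> -[[i j] u].
by rewrite !permM !permE /mover /moveb actb_vop.
Qed.

Ltac vec_ring := intros; rewrite /op /vop /vsum /=; split_vec; ring: q2.

Lemma vop_vrC v : op (vr q) v = op v (vr q).
Proof. by case: v => [[[k l] m] t]; vec_ring. Qed.

Lemma acta_vr : acta q (vr q) = vr q.
Proof.
rewrite /acta /vr; split_vec.
- apply: (eq_mod3q q3 (w := -1)%R); ring: q2.
- ring: q2.
- ring: q2.
- apply: (eq_mod3q q3 (w := 1)%R); ring: q2.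
Qed.

Lemma actb_vr : actb q (vr q) = vr q.
Proof.
rewrite /actb /vr; split_vec.
- apply: (eq_mod3q q3 (w := -1)%R); ring: q2.
- apply: (eq_mod3q q3 (w := 1)%R); ring: q2.
- ring: q2.
- ring: q2.
Qed.

(** The subgroup to be divided out: modulo it, the [q]-th powers of the basic
    commutators satisfy their linear relation. *)
Definition model_center : {group {perm T}} := <[permr (vr q)]>%G.

Lemma commute_vr_norm x : commute (permr (vr q)) x -> x \in 'N(model_center).
Proof.
move=> xC; apply: (subsetP (cent_sub _)); rewrite /= cent_cycle.
by apply/cent1P; apply: commute_sym.
Qed.

Lemma permr_norm v : permr v \in 'N(model_center).
Proof. by apply: commute_vr_norm; rewrite /commute !permrM vop_vrC. Qed.

Lemma perma_norm : perma \in 'N(model_center).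
Proof. by apply: commute_vr_norm; rewrite /commute conjgC permrJa acta_vr. Qed.

Lemma permb_norm : permb \in 'N(model_center).
Proof. by apply: commute_vr_norm; rewrite /commute conjgC permrJb actb_vr. Qed.

Definition modela := coset model_center perma.
Definition modelb := coset model_center permb.
Definition modelr v := coset model_center (permr v).

Lemma modelrM v w : modelr v * modelr w = modelr (op v w).
Proof. by rewrite /modelr -permrM morphM ?permr_norm. Qed.

Lemma modelr0 : modelr (vzero K) = 1.
Proof.
apply: (mulgI (modelr (vzero K))); rewrite modelrM mulg1; congr modelr; vec_ring.
Qed.

Lemma modelrV v : (modelr v)^-1 = modelr (vopp v).
Proof.
apply: mulg1_eq; rewrite modelrM -modelr0; congr modelr.
by case: v => [[[k l] m] t]; vec_ring.
Qed.

Lemma modelrX v s : modelr v ^+ s = modelr (vscale s%:R v).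
Proof.
elim: s => [|s IH].
  by rewrite expg0 -modelr0; congr modelr; case: v => [[[k l] m] t]; vec_ring.
rewrite expgS IH modelrM; congr modelr; case: v {IH} => [[[k l] m] t].
by rewrite -natr1; vec_ring.
Qed.

Lemma modelr_vr v : modelr (op v (vr q)) = modelr v.
Proof.
rewrite -modelrM [X in _ * X]coset_id ?mulg1 //; exact: cycle_id.
Qed.

Definition vcomm (v w : vec K) : vec K :=
  let: (k, l, m, t) := v in let: (k', l', m', t') := w in
  let h x x' := (q * (vsum v * x' - vsum w * x))%R in
  (h k k', h l l', h m m', h t t').

Lemma modelrR v w : [~ modelr v, modelr w] = modelr (vcomm v w).
Proof.
apply: (mulgI (modelr w * modelr v)); rewrite -commgC !modelrM; congr modelr.
move: v w => [[[v1 v2] v3] v4] [[[w1 w2] w3] w4]; rewrite /op /vop /vsum /vcomm.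
pose sv := (v1 + v2 + v3 + v4)%R; pose sw := (w1 + w2 + w3 + w4)%R.
split_vec.
- apply: (eq_mod3q q3 (w := - (sv * w1 - sw * v1))%R); rewrite /vsum /sv /sw; ring: q2.
- apply: (eq_mod3q q3 (w := - (sv * w2 - sw * v2))%R); rewrite /vsum /sv /sw; ring: q2.
- apply: (eq_mod3q q3 (w := - (sv * w3 - sw * v3))%R); rewrite /vsum /sv /sw; ring: q2.
- apply: (eq_mod3q q3 (w := - (sv * w4 - sw * v4))%R); rewrite /vsum /sv /sw; ring: q2.
Qed.

Lemma modelrJa v : modelr v ^ modela = modelr (acta q v).
Proof. by rewrite -morphJ ?perma_norm ?permr_norm // permrJa. Qed.

Lemma modelrJb v : modelr v ^ modelb = modelr (actb q v).
Proof. by rewrite -morphJ ?permb_norm ?permr_norm // permrJb. Qed.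

Lemma modela3 : modela ^+ 3 = 1.
Proof. by rewrite -morphX ?perma_norm //= perma3 morph1. Qed.

Lemma modelb3 : modelb ^+ 3 = 1.
Proof. by rewrite -morphX ?permb_norm //= permb3 morph1. Qed.

Lemma model_comm_c : [~ modela, modelb] = modelr (vc K).
Proof. by rewrite -morphR ?perma_norm ?permb_norm //= comm_permab. Qed.

Lemma model_comm_d : [~ modelb, modela ^+ 2] = modelr (vd K).
Proof.
rewrite -invgR expg2 commMg_conj model_comm_c modelrJa modelrM modelrV.
by congr modelr; vec_ring.
Qed.

Lemma comm_ab2 : [~ modela, modelb ^+ 2] = modelr (vopp (vf K)).
Proof.
rewrite expg2 commgM_conj model_comm_c modelrJb modelrM.
by congr modelr; vec_ring.
Qed.

Lemma model_comm_f : [~ modelb ^+ 2, modela] = modelr (vf K).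
Proof.
by rewrite -invgR comm_ab2 modelrV; congr modelr; vec_ring.
Qed.

Lemma model_comm_e : [~ modela ^+ 2, modelb ^+ 2] = modelr (ve K).
Proof.
rewrite expg2 commMg_conj comm_ab2 modelrJa modelrM.
by congr modelr; vec_ring.
Qed.

Hypothesis expn3_eq0 : (3 ^ n)%:R%R = 0%R :> K.

Lemma model_basic_comms : basic_comms modela modelb =
  [:: modelr (vc K); modelr (vd K); modelr (ve K); modelr (vf K)].
Proof.
by rewrite /basic_comms model_comm_c model_comm_d model_comm_e model_comm_f.
Qed.

Lemma mem_model_comms x : x \in basic_comms modela modelb ->
  exists2 v, vsum v = 1%R & x = modelr v.
Proof.
rewrite model_basic_comms !inE => /or4P[] /eqP->;
  [exists (vc K) | exists (vd K) | exists (ve K) | exists (vf K)] => //;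
  rewrite /vsum /=; ring.
Qed.

Lemma relations_model : relations n modela modelb.
Proof.
apply/relationsP=> //; split; first by rewrite modela3 modelb3.
- move=> _ /mem_model_comms[[[[k l] m] t] _ ->].
  by rewrite modelrX expn3_eq0 -modelr0; congr modelr; vec_ring.
- move=> _ _ /mem_model_comms[v sv ->] /mem_model_comms[w sw ->].
  rewrite !modelrX modelrV modelrR modelrM; congr modelr.
  move: v w sv sw => [[[k l] m] t] [[[k' l'] m'] t'] sv sw.
  rewrite /vcomm /vscale sv sw -/q; vec_ring.
- move=> _ _ /mem_model_comms[[[[k l] m] t] _ ->] /mem_model_comms[[[[k' l'] m'] t'] _ ->].
  by rewrite !modelrX /commute !modelrM -/q; congr modelr; vec_ring.
rewrite /= model_comm_c model_comm_d model_comm_e model_comm_f.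
split.
  rewrite !modelrX !modelrV !modelrM -/q -[LHS]modelr_vr; congr modelr; vec_ring.
have commJ (x y : coset_of model_center) : x ^ y = x -> commute x y.
  by move=> xy; rewrite /commute conjgC xy.
rewrite !modelrR; split; apply: commJ; rewrite ?(modelrJa, modelrJb).
- rewrite -[LHS]modelr_vr; congr modelr; rewrite /op /vop /vsum /=; split_vec;
    [apply: (eq_mod3q q3 (w := 1%R)) | | |]; ring: q2.
- rewrite -[LHS]modelr_vr; congr modelr; rewrite /op /vop /vsum /=; split_vec;
    [apply: (eq_mod3q q3 (w := 1%R)) | | |]; ring: q2.
- rewrite -[LHS]modelr_vr; congr modelr; rewrite /op /vop /vsum /=; split_vec;
    [| | | apply: (eq_mod3q q3 (w := -1)%R)]; ring: q2.
- rewrite -[RHS]modelr_vr; congr modelr; rewrite /op /vop /vsum /=; split_vec;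
    [| apply: (eq_mod3q q3 (w := 1%R)) | |]; ring: q2.
Qed.

Definition model_group : {group {perm T}} := <<[set perma; permb]>>%G.

Lemma permrX v s : permr v ^+ s = permr (vscale s%:R v).
Proof.
elim: s => [|s IH].
  rewrite expg0; apply/permP=> -[[i j] u]; rewrite perm1 permE /mover.
  congr (_, _, _); case: u v => [[[u1 u2] u3] u4] [[[k l] m] t]; vec_ring.
rewrite expgS IH permrM; congr permr; case: v {IH} => [[[k l] m] t].
by rewrite -natr1; vec_ring.
Qed.

Hypothesis natr_onto : forall x : K, exists m, x = m%:R%R.

(** Products of powers of the four basic translations give all translations, the
    exponents being obtained by solving the multiplication law coordinatewise. *)
Lemma permr_model v : permr v \in model_group.
Proof.
have ga : perma \in model_group by rewrite mem_gen // !inE eqxx.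
have gb : permb \in model_group by rewrite mem_gen // !inE eqxx orbT.
have gc : permr (vc K) \in model_group by rewrite -comm_permab groupR.
have scale w x : permr w \in model_group -> permr (vscale x w) \in model_group.
  by have [m ->] := natr_onto x => gw; rewrite -permrX groupX.
have gd : permr (vd K) \in model_group.
  suff <- : acta q (acta q (vc K)) = vd K by rewrite -!permrJa !groupJ.
  rewrite /acta /=; split_vec; [apply: (eq_mod3q q3 (w := 1%R)) | | |]; ring: q2.
have ge : permr (ve K) \in model_group.
  suff <- : actb q (actb q (vd K)) = ve K by rewrite -!permrJb !groupJ.
  rewrite /actb /=; split_vec; [| apply: (eq_mod3q q3 (w := 1%R)) | |]; ring: q2.
have gf : permr (vf K) \in model_group.
  suff <- : actb q (actb q (vc K)) = vf K by rewrite -!permrJb !groupJ.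
  rewrite /actb /=; split_vec; [apply: (eq_mod3q q3 (w := - 1)%R) | | |]; ring: q2.
case: v => [[[k l] m] t].
suff -> : (k, l, m, t) = op (op (op
    (vscale (k - q * (k * l + k * m + k * t))%R (vc K))
    (vscale (l + q * (k * l - l * m - l * t))%R (vd K)))
    (vscale (m + q * (k * m + l * m - m * t))%R (ve K)))
    (vscale (t + q * (k * t + l * t + m * t))%R (vf K)).
  by rewrite -!permrM !groupM ?scale.
by vec_ring.
Qed.

Definition origin : T := (ord0, ord0, vzero K).

Lemma model_transitive x : exists2 p, p \in model_group & p origin = x.
Proof.
case: x => -[i j] v; exists (perma ^+ i * permb ^+ j * permr v).
  have ga : perma \in model_group by rewrite mem_gen // !inE eqxx.
  have gb : permb \in model_group by rewrite mem_gen // !inE eqxx orbT.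
  by rewrite !groupM ?groupX ?permr_model.
have a0 : (perma ^+ i) origin = (i, ord0, vzero K).
  case: i => -[|[|[|//]]] i3; rewrite ?expg2 ?permM ?perm1 ?permE /movea /origin /=;
    congr (_, _, _); try exact: val_inj; by rewrite /vop /=; split_vec; ring.
have b0 : (permb ^+ j) (i, ord0, vzero K) = (i, j, vzero K).
  case: j => -[|[|[|//]]] j3; rewrite ?expg2 ?permM ?perm1 ?permE /moveb /=;
    congr (_, _, _); try exact: val_inj; by rewrite /actb /=; split_vec; ring.
rewrite !permM a0 b0 permE /mover; congr (_, _, _).
by case: v => [[[k l] m] t]; vec_ring.
Qed.

Hypothesis card_K : #|{: K}| = (3 ^ n)%N.

(** The permutation group is transitive on [3^(4 * n + 2)] points, and the central
    subgroup has order at most 3. *)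
Lemma card_model : (3 ^ (4 * n + 1) <= #|<<[set modela; modelb]>>|)%N.
Proof.
have leT : (#|T| <= #|model_group|)%N.
  rewrite -cardsT (_ : setT = [set (p : {perm T}) origin | p in model_group]) ?leq_imset_card //.
  apply/setP=> x; rewrite inE; have [p pG <-] := model_transitive x.
  by rewrite imset_f.
have ZG : model_center \subset model_group by rewrite cycle_subG permr_model.
have leZ : (#|model_center| <= 3)%N.
  rewrite dvdn_leq // order_dvdn permrX; apply/eqP/permP=> -[[i j] u].
  rewrite perm1 permE /mover; congr (_, _, _).
  case: u => [[[u1 u2] u3] u4]; rewrite /vop /vsum /=; split_vec.
  - apply: (eq_mod3q q3 (w := 1)%R); ring: q2.
  - apply: (eq_mod3q q3 (w := - 1)%R); ring: q2.
  - apply: (eq_mod3q q3 (w := 1)%R); ring: q2.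
  - apply: (eq_mod3q q3 (w := - 1)%R); ring: q2.
have norm_ab : [set perma; permb] \subset 'N(model_center).
  by apply/subsetP=> x /set2P[] ->; rewrite ?perma_norm ?permb_norm.
have -> : <<[set modela; modelb]>> = model_group / model_center.
  rewrite quotient_gen //; congr <<_>>; rewrite quotientE morphimEsub //.
  by rewrite imsetU1 imset_set1.
rewrite card_quotient; last by rewrite gen_subG.
rewrite -(leq_pmul2l (isT : 0 < 3)%N) -expnS.
apply: leq_trans (leq_mul leZ (leqnn _)); rewrite Lagrange //.
apply: leq_trans leT; rewrite !card_prod card_K !card_ord.
by rewrite (_ : (4 * n + 1).+1 = 2 + (n + n + n + n))%N ?expnD //; lia.
Qed.

End ModelGroup.


(** * Existence, order and symmetries of the presented group *)

Lemma presented_generated n (G : finGroupType) (a b : G) :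
  (0 < n)%N -> relations n a b -> (3 ^ (4 * n + 1) <= #|<<[set a; b]>>|)%N ->
  exists (R : finGroupType) (x y : R),
    presented n x y /\ (3 ^ (4 * n + 1) <= #|R|)%N.
Proof.
move=> n_gt0 rel leG; set H := <<[set a; b]>>%G.
have ha : a \in H by rewrite mem_gen // !inE eqxx.
have hb : b \in H by rewrite mem_gen // !inE eqxx orbT.
have cH : #|{: subg_of H}| = #|<<[set a; b]>>| by rewrite -cardsT (card_isog (isog_subg H)).
exists (subg_of H), (subg H a), (subg H b).
have {}leG : (3 ^ (4 * n + 1) <= #|{: subg_of H}|)%N by rewrite cH.
split=> //; apply: presented_of_card => //.
  have -> : [set subg H a; subg H b] = subg H @* [set a; b].
    rewrite morphimEsub; last by apply/subsetP=> x /set2P[] ->.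
    by rewrite imsetU1 imset_set1.
  by rewrite -morphim_gen ?im_subg //; apply/subsetP=> x /set2P[] ->.
apply: (relations_inj (p := @sgval _ H)) => //; last by rewrite !subgK.
exact: val_inj.
Qed.

Lemma presented_exists n : (2 <= n)%N -> exists (R : finGroupType) (a b : R),
  presented n a b /\ (3 ^ (4 * n + 1) <= #|R|)%N.
Proof.
move=> n2; have n_gt0 : (0 < n)%N by lia.
pose K : finComNzRingType := 'Z_(3 ^ n)%N.
have n3 : (1 < 3 ^ n)%N by rewrite -{1}(expn0 3) ltn_exp2l.
have K0 m : (3 ^ n %| m)%N -> m%:R%R = 0%R :> K.
  by move=> dv; apply: val_inj; rewrite /= val_Zp_nat //; apply/eqP.
have q2 : ((3 ^ n.-1)%:R ^+ 2)%R = 0%R :> K.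
  by rewrite -natrX -expnM K0 // dvdn_exp2l //; lia.
have q3 : (3 * (3 ^ n.-1)%:R)%R = 0%R :> K.
  by rewrite -natrM -expnS prednK // K0.
have q0 : (3 ^ n)%:R%R = 0%R :> K by rewrite K0.
have onto (x : K) : exists m, x = m%:R%R by exists x; rewrite natr_Zp.
have cK : #|{: K}| = (3 ^ n)%N by rewrite card_ord Zp_cast.
exact: presented_generated n_gt0 (relations_model n_gt0 q2 q3 q0)
  (card_model n_gt0 q2 q3 onto cK).
Qed.

(** The universal property provides a homomorphism onto the model. *)
Lemma presented_leq_card n (R : finGroupType) (a b : R) :
  (2 <= n)%N -> presented n a b -> (3 ^ (4 * n + 1) <= #|R|)%N.
Proof.
move=> n2 [_ _ univ]; have [M [x [y [[gen rel _] leM]]]] := presented_exists n2.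
have [phi [phia phib]] := univ M x y rel.
suff imT : [set phi z | z in R] = setT.
  by rewrite (leq_trans leM) // -[X in (X <= _)%N]cardsT -imT leq_imset_card.
have phiM : {morph phi : u v / u * v} by move=> u v; rewrite gmulfM.
apply/setP=> z; rewrite inE; move: z; apply: (gen_indr gen).
- by apply/imsetP; exists 1; rewrite ?(morph_group1 phiM).
- by move=> _ /imsetP[u _ ->]; apply/imsetP; exists (u * a); rewrite // phiM phia.
- by move=> _ /imsetP[u _ ->]; apply/imsetP; exists (u * b); rewrite // phiM phib.
Qed.

Section Presented.
Variables (n : nat) (R : finGroupType) (a b : R).
Hypotheses (n_ge2 : (2 <= n)%N) (presR : presented n a b).
Let q := (3 ^ n.-1)%N.
Let n_gt0 : (0 < n)%N. Proof. exact: leq_trans n_ge2. Qed.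
Let gen_ab : <<[set a; b]>> = [set: R]. Proof. by case: presR. Qed.
Let rel_ab : relations n a b. Proof. by case: presR. Qed.

Lemma presented_card : #|R| = (3 ^ (4 * n + 1))%N.
Proof. by case: (normal_form_inj n_gt0 gen_ab rel_ab (presented_leq_card n_ge2 presR)). Qed.

Lemma presented_nf_inj : injective (@normal_form n _ a b).
Proof. by case: (normal_form_inj n_gt0 gen_ab rel_ab (presented_leq_card n_ge2 presR)). Qed.

Lemma presented_cube_a : a ^+ 3 = 1. Proof. by case: rel_ab => -[]. Qed.
Lemma presented_cube_b : b ^+ 3 = 1. Proof. by case: rel_ab => -[]. Qed.

Lemma presented_cycles_indep (i j : nat) : (i < 3)%N -> (j < 3)%N ->
  a ^+ i * b ^+ j = 1 -> i = 0 /\ j = 0.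
Proof.
move=> i3 j3 E.
have q0 : (0 < 3 ^ n.-1)%N by rewrite expn_gt0.
have N0 : (0 < 3 ^ n)%N by rewrite expn_gt0.
pose nf (i j : 'I_3) : nf_index n := (i, j, (Ordinal N0, Ordinal N0, Ordinal N0, Ordinal q0)).
have := @presented_nf_inj (nf (Ordinal i3) (Ordinal j3)) (nf ord0 ord0).
by rewrite /normal_form /= !expg0 !mulg1 => /(_ E)[].
Qed.

(** The relations being invariant under the cyclic shift [a, b, a^2, b^2], the universal
    property turns this shift into an automorphism. *)
Lemma presented_rotation :
  exists2 phi : {perm R}, phi \in Aut [set: R] & phi a = b /\ phi b = a ^+ 2.
Proof.
have [_ _ univ] := presR.
have [phi [phia phib]] := univ _ _ _ (relations_rot n_gt0 rel_ab).
have phiM : {morph phi : u v / u * v} by move=> u v; rewrite gmulfM.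
have surj z : exists u, phi u = z.
  move: z; apply: (gen_indr gen_ab) => [|_ [u <-]|_ [u <-]].
  - by exists 1; apply: (morph_group1 phiM).
  - exists (u * b ^+ 2); rewrite phiM (morph_groupX phiM) phib.
    by rewrite sqr_sqr_cube1 // presented_cube_a.
  - by exists (u * a); rewrite phiM phia.
have inj : injective phi.
  apply/injectiveP/card_uniqP; rewrite size_map -cardE.
  by apply: eq_card => z; have [u <-] := surj z; rewrite codom_f.
exists (perm inj); last by rewrite !permE.
rewrite inE; apply/andP; split; first by apply/subsetP=> x; rewrite inE.
by apply/morphicP=> x y _ _; rewrite !permE.
Qed.

(** Such an automorphism would exchange [c] with [f^-1], and then the law
    [[c, f] = c^-q f^q] would give [c^q = f^q], which the normal forms forbid. *)
Lemma presented_no_reflection (phi : {perm R}) : phi \in Aut [set: R] ->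
  phi a = a -> phi b = b ^+ 2 -> False.
Proof.
move=> phiA phia phib.
have phiM : {morph phi : u v / u * v}.
  move=> u v; move: phiA; rewrite inE => /andP[_ /morphicP]; exact.
have [_ ord comm cent [fq _]] := (relationsP n_gt0 a b).1 rel_ab.
set c := [~ a, b] in comm cent fq ord; set f := [~ b ^+ 2, a] in comm cent fq.
have mc : c \in basic_comms a b by rewrite !inE eqxx.
have mf : f \in basic_comms a b by rewrite !inE eqxx ?orbT.
have phic : phi c = f^-1.
  by rewrite (morph_groupR phiM) phia phib invgR.
have phif : phi f = c^-1.
  rewrite (morph_groupR phiM) (morph_groupX phiM) phia phib.
  by rewrite sqr_sqr_cube1 ?presented_cube_b // invgR.
clearbody c f.
have cq3 : (c ^+ q) ^+ 3 = 1 by rewrite -expgnA -expn3_pred // ord.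
have fq3 : (f ^+ q) ^+ 3 = 1 by rewrite -expgnA -expn3_pred // ord.
have E : f ^- q * c ^+ q = f ^+ q * c ^- q.
  have := congr1 phi (comm _ _ mc mf).
  rewrite (morph_groupR phiM c f) phiM (morph_groupV phiM).
  rewrite !(morph_groupX phiM) phic phif !expVgn invgK => <-.
  rewrite -(comm _ _ mf mc) [RHS]commgEl conjgE !invgK.
  have fcC : commute [~ f, c] (c * f).
    rewrite comm //; apply: commuteM; apply/commute_sym/commuteM.
    - exact/commuteV/commute_sym/cent.
    - exact/commute_sym/cent.
    - exact/commuteV/commute_sym/cent.
    - exact/commute_sym/cent.
  by rewrite mulgA (commgC f c) -[c * f * _]fcC !mulgA !mulgK.
have cf : c ^+ q = f ^+ q.
  have qC : commute (c ^+ q) (f ^- q) by apply/commuteV/commuteX/cent.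
  apply: (can_inj (@invgK R)); rewrite -(sqr_cube1 cq3) -(sqr_cube1 fq3) !expg2.
  apply: (mulgI (f ^- q)); rewrite mulgA E.
  by rewrite mulKg mulgVK.
move: fq; rewrite -cf -mulgA -[LHS]mulg1 => /mulgI/esym/(congr1 (mulg ([~ b, a ^+ 2] ^+ q))).
rewrite mulKVg mulg1 => E2.
have q0 : (0 < 3 ^ n.-1)%N by rewrite expn_gt0.
have N0 : (0 < 3 ^ n)%N by rewrite expn_gt0.
have qN : (q < 3 ^ n)%N by rewrite ltn_exp2l // prednK.
pose i0 : 'I_3 := ord0.
have := @presented_nf_inj
  (i0, i0, (Ordinal N0, Ordinal N0, Ordinal qN, Ordinal q0))
  (i0, i0, (Ordinal N0, Ordinal qN, Ordinal N0, Ordinal q0)).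
rewrite /normal_form /= !expg0 !mulg1 !mul1g => /(_ E2)[] /esym/eqP.
by rewrite expn_eq0.
Qed.

End Presented.

(** * Recognising the cyclic group of order 4 and the symmetric group of degree 3 *)

Lemma isog_Z4 (gT : finGroupType) (x : gT) : #[x] = 4 -> <[x]> \isog [set: 'Z_4].
Proof.
move=> ox; have := Zp_isog x; rewrite ox => Zx.
by rewrite isog_sym; apply: isog_trans Zx; rewrite /Zp /= isog_refl.
Qed.

Lemma isog_dihedral6 (gT : finGroupType) (x y : gT) :
  #[x] = 3 -> #[y] = 2 -> x ^ y = x^-1 ->
  <<[set x; y]>> \isog 'D_6 /\ #|<<[set x; y]>>| = 6.
Proof.
move=> ox oy xy.
have y2 : y * y = 1 by rewrite -expg2 -oy expg_order.
have xyxy : x * y * (x * y) = 1.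
  have yxy : y * (x * y) = x^-1 by rewrite -xy conjgE (mulg1_eq y2).
  by rewrite -mulgA yxy mulgV.
have gen2 : <<[set x * y; y]>> = <<[set x; y]>>.
  have y_in (z : gT) : y \in <<[set z; y]>> by rewrite mem_gen // !inE eqxx orbT.
  have z_in (z : gT) : z \in <<[set z; y]>> by rewrite mem_gen // !inE eqxx.
  apply/eqP; rewrite eqEsubset !gen_subG; apply/andP; split; apply/subsetP=> z.
    by case/set2P=> ->; rewrite ?groupM ?y_in ?z_in.
  by case/set2P=> ->; rewrite ?y_in // -{1}(mulgK y x) groupM ?groupV ?y_in ?z_in.
have cG : #|<<[set x; y]>>| = 6.
  have nxy : y \in 'N(<[x]>).
    by rewrite inE -cycleJ xy cycleV.
  have -> : <<[set x; y]>> = <[x]> * <[y]>.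
    by rewrite -norm_joinEr ?cycle_subG // joing_idl joing_idr.
  by rewrite TI_cardMg -?orderE ?ox ?oy // coprime_TIg // -!orderE ox oy.
split=> //; have := @involutions_gen_dihedral _ (x * y) y.
rewrite /= gen2 cG; apply=> //; last first.
  apply/eqP=> E; have x1 : x = 1 by apply: (mulIg y); rewrite mul1g.
  by move: ox; rewrite x1 order1.
apply: nt_prime_order => //; rewrite ?expg2 //.
by apply/eqP=> /mulg1_eq E; move: oy; rewrite -E orderV ox.
Qed.

Lemma isog_S3 (gT : finGroupType) (x y : gT) :
  #[x] = 3 -> #[y] = 2 -> x ^ y = x^-1 -> <<[set x; y]>> \isog [set: {perm 'I_3}].
Proof.
move=> ox oy xy; have [isoD _] := isog_dihedral6 ox oy xy.
apply: isog_trans isoD _; rewrite isog_sym.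
pose o0 : 'I_3 := ord0; pose o1 : 'I_3 := inord 1; pose o2 : 'I_3 := inord 2.
pose s := tperm o0 o1; pose t := tperm o1 o2.
have n01 : o0 != o1 by rewrite -val_eqE /= inordK.
have n12 : o1 != o2 by rewrite -val_eqE /= !inordK.
have n02 : o0 != o2 by rewrite -val_eqE /= inordK.
have all3 (i : 'I_3) : [\/ i = o0, i = o1 | i = o2].
  by case: i => -[|[|[|//]]] ?; [apply: Or31 | apply: Or32 | apply: Or33];
    apply: val_inj; rewrite /= ?inordK.
have ss : s * s = 1 := tperm2 _ _; have tt : t * t = 1 := tperm2 _ _.
have n1 : s != 1.
  by apply/eqP=> /permP/(_ o0); rewrite tpermL perm1; apply/eqP; rewrite eq_sym.
have oS : #[s] = 2 by apply: nt_prime_order; rewrite ?expg2.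
have st0 : (s * t) o0 = o2 by rewrite permM tpermL tpermL.
have st1 : (s * t) o1 = o0 by rewrite permM tpermR tpermD // eq_sym.
have st2 : (s * t) o2 = o1 by rewrite permM [s _]tpermD // tpermR.
have oT : #[s * t] = 3.
  apply: nt_prime_order => //.
    apply/permP=> i; rewrite perm1 !expgS expg0 mulg1 !permM -!(permM s t).
    by case: (all3 i) => ->; rewrite !(st0, st1, st2).
  by apply/eqP=> /permP/(_ o0); rewrite st0 perm1; apply/eqP; rewrite eq_sym.
have sts : (s * t) ^ s = (s * t)^-1.
  by rewrite conjgE -mulgA mulKg invMg (mulg1_eq ss) (mulg1_eq tt).
have [isoS cS] := isog_dihedral6 oT oS sts.
suff E : <<[set s * t; s]>> = [set: {perm 'I_3}] by move: isoS; rewrite E.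
apply/eqP; rewrite eqEcard subsetT /= cS cardsT.
by have /= -> := card_Sn 3.
Qed.

(** * Normality of a Sylow 3-subgroup generated by two vertex stabilisers *)

Section Amalgam.
Variables (gT : finGroupType) (G E R : {group gT}).
Hypotheses (sEG : E \subset G) (sRG : R \subset G).
Hypotheses (E2 : 2.-group E) (R3 : 3.-group R).
Hypothesis cardG : #|G| = (#|R| * #|E|)%N.

Let E3' : 3^'.-nat #|E|. Proof. exact: pi_pnat E2 _. Qed.
Let R2' : 2^'.-nat #|R|. Proof. exact: pi_pnat R3 _. Qed.

Let sylR : 3.-Sylow(G) R.
Proof.
rewrite pHallE sRG cardG partnM ?cardG_gt0 // (part_pnat_id R3).
by rewrite (part_p'nat E3') muln1 eqxx.
Qed.

Let sylE : 2.-Sylow(G) E.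
Proof.
rewrite pHallE sEG cardG partnM ?cardG_gt0 // (part_pnat_id E2).
by rewrite (part_p'nat R2') mul1n eqxx.
Qed.

(** If [K] is an extension of [O_3(G)] by a 2-group, its trace on a vertex stabiliser
    [A] is a 2-group unless the elements of order 3 of [A] lie in [O_3(G)], and being
    normal in [A] it lies in the Sylow subgroup [E]. *)
Lemma vertex_stab_trace (A K : {group gT}) x :
  A \subset G -> E \subset A -> #|A| = (3 * #|E|)%N -> x \in A -> #[x] = 3 ->
  x \notin 'O_3(G) -> K <| G -> 2.-group (K / 'O_3(G)) -> K :&: A \subset E.
Proof.
move=> sAG sEA cardA Ax ox xP nKG KP2.
have nPG : G \subset 'N('O_3(G)) := gFnorm _ _.
have sylx y : y \in A -> #[y] = 3 -> 3.-Sylow(A) <[y]>.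
  move=> Ay oy; rewrite pHallE cycle_subG Ay -orderE oy cardA partnM //.
  by rewrite (part_p'nat E3') muln1 part_pnat_id.
have sylEA : 2.-Sylow(A) E by apply: pHall_subl sylE.
have nKA : K :&: A <| A by rewrite setIC (normalGI sAG).
suff KA2 : 2.-group (K :&: A).
  by apply: subset_trans (pcore_max KA2 nKA) (pcore_sub_Hall sylEA).
apply/pgroupP=> p p_pr /Cauchy-/(_ p_pr)[z /setIP[Kz Az] oz].
have: p %| 3 * #|E| by rewrite -cardA -oz order_dvdG.
rewrite Euclid_dvdM // => /orP[|pE]; last exact: (pgroupP E2).
rewrite dvdn_prime2 // => /eqP p3; case/negP: xP.
have Pz : z \in 'O_3(G).
  have nPz : z \in 'N('O_3(G)) by rewrite (subsetP nPG) ?(subsetP sAG).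
  apply: coset_idr => //; apply/eqP; rewrite -order_eq1.
  have dvd3 : #[coset 'O_3(G) z] %| 3.
    by rewrite (dvdn_trans (morph_order _ nPz)) // oz p3.
  have := mem_p_elt KP2 (mem_quotient 'O_3(G) Kz).
  by case/primeP: (isT : prime 3) => _ /(_ _ dvd3) /orP[] /eqP oz1; rewrite /p_elt oz1 // pnatE.
have [u Au xE] := Sylow_trans (sylx z Az (etrans oz p3)) (sylx x Ax ox).
rewrite -cycle_subG xE sub_conjg (normP _) ?cycle_subG //.
by rewrite groupV (subsetP nPG) ?(subsetP sAG).
Qed.

Variables (A B : {group gT}) (x y : gT).
Hypotheses (sAG : A \subset G) (sBG : B \subset G).
Hypotheses (sEA : E \subset A) (sEB : E \subset B).
Hypotheses (cardA : #|A| = (3 * #|E|)%N) (cardB : #|B| = (3 * #|E|)%N).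
Hypotheses (Ax : x \in A) (ox : #[x] = 3) (By : y \in B) (oy : #[y] = 3).
Hypothesis genR : <<[set x; y]>> = R.
Hypothesis core_free :
  forall T : {group gT}, T \subset E -> R \subset 'N(T) -> T :=: 1.
Hypothesis swap : (x \in 'O_3(G)) = (y \in 'O_3(G)).

(** Were [x] and [y] outside [P = O_3(G)], a minimal normal subgroup [K / P] of
    [G / P] would be a 2-group; the traces of [K] on [A], on [B] and on [E] would then
    coincide, so be normalised by [x] and [y], hence trivial.  But the trace on [E] is
    a Sylow 2-subgroup of [K]. *)
Lemma pcore3_generated : 'O_3(G) = R.
Proof.
have sub_gen (H : {group gT}) : x \in H -> y \in H -> R \subset H.
  move=> Hx Hy; rewrite -genR gen_subG.
  by apply/subsetP=> z /set2P[] ->.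
have [Px|] := boolP (x \in 'O_3(G)).
  apply/eqP; rewrite eqEsubset (pcore_sub_Hall sylR) sub_gen //.
  by rewrite -swap.
move=> Px; have Py : y \notin 'O_3(G) by rewrite -swap.
have nPG : G \subset 'N('O_3(G)) := gFnorm _ _.
have solG : solvable (G / 'O_3(G)).
  apply: quotient_sol; apply: Burnside_p_a_q_b.
  apply: (uniq_leq_size (primes_uniq _) (s2 := [:: 2; 3])) => r.
  rewrite mem_primes cardG => /and3P[r_pr _]; rewrite Euclid_dvdM // !inE.
  by case/orP=> [/(pgroupP R3 _ r_pr) | /(pgroupP E2 _ r_pr)] /eqnP->.
have ntG : G / 'O_3(G) != 1.
  apply: contra Px => /eqP GP1; have := quotient_sub1 nPG.
  by rewrite GP1 sub1G => /esym/subsetP->; rewrite ?(subsetP sAG).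
have [M minM sMG] := minnormal_exists ntG (normG _).
have [_ ntM /is_abelemP[p p_pr abM]] := minnormal_solvable minM sMG solG.
have nMG : M <| G / 'O_3(G) by rewrite /normal sMG; case/mingroupp/andP: minM.
have pM : p.-group M := abelem_pgroup abM.
have p2 : p = 2.
  have: p %| #|R| * #|E|.
    rewrite -cardG (dvdn_trans _ (dvdn_quotient _ 'O_3(G))) //.
    rewrite (dvdn_trans _ (cardSg sMG)) //.
    by have [_ ? _] := pgroup_pdiv pM ntM.
  rewrite Euclid_dvdM // => /orP[pR|pE]; last exact/eqP/(pgroupP E2).
  have p3 : p = 3 by apply/eqP/(pgroupP R3).
  case/eqP: ntM; apply/trivgP; rewrite -(trivg_pcore_quotient 3 G).
  by rewrite pcore_max //; move: pM; rewrite p3.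
have [K defM sPK nKG] := inv_quotientN (pcore_normal 3 G) nMG.
have KP2 : 2.-group (K / 'O_3(G)) by move: pM; rewrite p2 defM.
have tA := vertex_stab_trace sAG sEA cardA Ax ox Px nKG KP2.
have tB := vertex_stab_trace sBG sEB cardB By oy Py nKG KP2.
have eqA : K :&: A = K :&: E.
  by apply/eqP; rewrite eqEsubset subsetI subsetIl /= setIS ?andbT.
have eqB : K :&: B = K :&: E.
  by apply/eqP; rewrite eqEsubset subsetI subsetIl /= setIS ?andbT.
have T1 : K :&: E = 1.
  apply: core_free; first exact: subsetIr.
  have nKA : A \subset 'N(K :&: E).
    by rewrite -eqA normsI ?normG // (subset_trans sAG) ?normal_norm.
  have nKB : B \subset 'N(K :&: E).
    by rewrite -eqB normsI ?normG // (subset_trans sBG) ?normal_norm.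
  by apply: sub_gen; [apply: (subsetP nKA) | apply: (subsetP nKB)].
have K2 := card_Hall (Sylow_setI_normal nKG sylE); rewrite /= T1 cards1 in K2.
case/negP: ntM; rewrite trivg_card_le1.
have M2 : 2.-group M by rewrite defM.
rewrite -(part_pnat_id M2); apply: (@leq_trans #|K|`_2); last by rewrite -K2.
by rewrite dvdn_leq // partn_dvd // defM dvdn_quotient.
Qed.

End Amalgam.

(** * Automorphisms of the Cayley graph *)

Section CayleyGraph.
Variables (R : finGroupType) (a b : R).
Hypotheses (a3 : a ^+ 3 = 1) (b3 : b ^+ 3 = 1) (gen_ab : <<[set a; b]>> = [set: R]).
Hypothesis indep : forall i j : nat, (i < 3)%N -> (j < 3)%N ->
  a ^+ i * b ^+ j = 1 -> i = 0 /\ j = 0.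

Definition conn : {set R} := [set a; a ^+ 2; b; b ^+ 2].
Notation Y := (cayley conn).

(** The two families of cosets are indexed by a boolean so that an automorphism
    exchanging them acts by exclusive or. *)
Definition gtr (i : bool) : R := if i then a else b.

Definition same (i : bool) : rel R := [rel x y | y * x^-1 \in <[gtr i]>].

Lemma gtr3 i : gtr i ^+ 3 = 1. Proof. by case: i. Qed.

Lemma gtr_neq1 i : gtr i != 1.
Proof.
apply/eqP; case: i => g1.
  by have [] := @indep 1 0 isT isT; rewrite ?expg1 ?expg0 ?mulg1.
by have [] := @indep 0 1 isT isT; rewrite ?expg1 ?expg0 ?mul1g.
Qed.

Lemma order_gtr i : #[gtr i] = 3.
Proof. by apply: nt_prime_order; rewrite ?gtr3 ?gtr_neq1. Qed.

Lemma mem_gtr i x : x \in <[gtr i]> -> [\/ x = 1, x = gtr i | x = gtr i ^+ 2].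
Proof.
case/cyclePmin=> k; rewrite order_gtr.
by case: k => [|[|[|//]]] _ ->; [apply: Or31 | apply: Or32 | apply: Or33].
Qed.

Lemma gtr_TI i x : x \in <[gtr i]> -> x \in <[gtr (~~ i)]> -> x = 1.
Proof.
have TI y : y \in <[a]> -> y \in <[b]> -> y = 1.
  case/cyclePmin=> k; rewrite (order_gtr true) => k3 ->.
  rewrite -groupV => /cyclePmin[l]; rewrite (order_gtr false) => l3 E.
  have [] := @indep k l k3 l3; first by rewrite -E mulgV.
  by move->.
by case: i => /= ? ?; apply: TI.
Qed.

Lemma sameC i x y : same i x y = same i y x.
Proof. by rewrite /same /= -groupV invMg invgK. Qed.

Lemma same_refl i x : same i x x.
Proof. by rewrite /same /= mulgV group1. Qed.

Lemma same_trans i y x z : same i x y -> same i y z -> same i x z.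
Proof.
rewrite /same /= => xy yz.
by rewrite -(divgKA y) groupM.
Qed.

Lemma same_gtr i x : same i x (gtr i * x).
Proof. by rewrite /same /= mulgK cycle_id. Qed.

Lemma same_mul i x y g : same i (x * g) (y * g) = same i x y.
Proof. by rewrite /same /= invMg mulgA mulgK. Qed.

Lemma same_TI i x y : same i x y -> same (~~ i) x y -> x = y.
Proof. by move=> xy xy'; apply/esym/divg1_eq; apply: gtr_TI xy'. Qed.

Lemma same_eq i j x y : x != y -> same i x y -> same j x y -> i = j.
Proof.
move=> /eqP xy si sj; have [// | ij] := eqVneq i j.
by case: xy; apply: (same_TI si); move: ij sj; case: i {si}; case: j.
Qed.

Lemma conn_mem x : (x \in conn) = (x != 1) && [exists i, x \in <[gtr i]>].
Proof.
apply/idP/andP=> [|[x1 /existsP[i /mem_gtr[]]]].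
- have n1 i : gtr i ^+ 2 != 1.
    by rewrite sqr_cube1 ?gtr3 // invg_eq1 gtr_neq1.
  rewrite !inE -!orbA => /or4P[] /eqP->.
  + by rewrite (gtr_neq1 true); split=> //; apply/existsP; exists true; apply: cycle_id.
  + by rewrite (n1 true); split=> //; apply/existsP; exists true; apply: mem_cycle.
  + by rewrite (gtr_neq1 false); split=> //; apply/existsP; exists false; apply: cycle_id.
  + by rewrite (n1 false); split=> //; apply/existsP; exists false; apply: mem_cycle.
- by move=> E; rewrite E eqxx in x1.
- by move->; case: i; rewrite !inE eqxx ?orbT.
- by move->; case: i; rewrite !inE eqxx ?orbT.
Qed.

Lemma adjP x y : reflect (x != y /\ exists i, same i x y) (Y x y).
Proof.
rewrite /cayley /= conn_mem -[_ * _ == 1]divg_eq1 invg1 mulg1 divg_eq1 eq_sym.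
by apply: (iffP andP) => -[xy /existsP].
Qed.

Lemma adj_same i x y : x != y -> same i x y -> Y x y.
Proof. by move=> xy sxy; apply/adjP; split=> //; exists i. Qed.

Lemma same_cross i k x y z :
  same i x y -> same (~~ i) x z -> same k y z -> x = y \/ x = z.
Proof.
move=> xy xz yz; have [ki | ki] := eqVneq k i.
  by right; apply: same_TI xz; apply: same_trans xy _; rewrite -ki.
left; apply: (same_TI xy); apply: same_trans xz _.
by rewrite sameC; move: ki yz; case: k; case: (i).
Qed.

Lemma triangle_same i x y z :
  x != y -> same i x y -> Y x z -> Y y z -> same i x z.
Proof.
move=> xy sxy /adjP[xz [k sxz]] /adjP[_ [l syz]].
have [<- // | ki] := eqVneq k i.
have sxz' : same (~~ i) x z by move: ki sxz; case: k; case: (i).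
by have [] := same_cross sxy sxz' syz; move/eqP; rewrite ?(negPf xy) ?(negPf xz).
Qed.

Lemma graph_autP (T : finType) (r : rel T) (p : {perm T}) :
  reflect (forall x y, r (p x) (p y) = r x y) (p \in graph_aut r).
Proof.
rewrite inE; apply: (iffP forallP) => [H x y | H x].
  exact/eqP/(forallP (H x)).
by apply/forallP=> y; apply/eqP.
Qed.

(** Triangles of the graph lie in cosets, so an automorphism maps cosets to cosets; it
    keeps or exchanges the two families in the same way at adjacent vertices, hence,
    the graph being connected, everywhere. *)
Lemma aut_type (p : {perm R}) : p \in graph_aut Y ->
  exists tau, forall i x y, same (i (+) tau) (p x) (p y) = same i x y.
Proof.
move=> /graph_autP pY.
have pne x y : (p x != p y) = (x != y) by rewrite (inj_eq perm_inj).
have loc x : exists tau, forall i y, same i x y -> same (i (+) tau) (p x) (p y).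
  pose y0 := gtr true * x.
  have x_y0 : x != y0 by rewrite eq_sym -divg_eq1 mulgK gtr_neq1.
  have: Y (p x) (p y0) by rewrite pY (adj_same x_y0 (same_gtr true x)).
  case/adjP=> _ [j sj]; exists (~~ j) => i y sxy.
  have [<- | xy] := eqVneq x y; first exact: same_refl.
  have Yxy : Y (p x) (p y) by rewrite pY (adj_same xy sxy).
  case: i sxy => sxy /=.
    rewrite negbK; have [<- // | y0y] := eqVneq y0 y.
    have Yy0y : Y (p y0) (p y).
      rewrite pY; apply: (adj_same (i := true)) => //; apply: same_trans sxy.
      by rewrite sameC same_gtr.
    by apply: triangle_same Yy0y; rewrite ?pne.
  have /adjP[_ [k sk]] := Yxy.
  have [kj | kj] := eqVneq k j; last by move: kj sk; case: k; case: (j).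
  have syy0 : same j (p y) (p y0).
    by apply: same_trans sj; rewrite sameC -kj.
  have sx_y0 : same (~~ false) x y0 := same_gtr true x.
  have [yy0 | yy0] := eqVneq y y0.
    by case/eqP: xy; apply: (same_TI sxy); rewrite yy0.
  have /adjP[_ [l syl]] : Y y y0 by rewrite -pY; apply: adj_same syy0; rewrite pne.
  have [/eqP|/eqP] := same_cross sxy sx_y0 syl.
    by rewrite (negPf xy).
  by rewrite (negPf x_y0).
have [tau tau1] := loc 1; exists tau.
have step s x : (forall i y, same i x y -> same (i (+) tau) (p x) (p y)) ->
    (forall i y, same i (gtr s * x) y -> same (i (+) tau) (p (gtr s * x)) (p y)).
  move=> Hx; set z := gtr s * x; have [tz Hz] := loc z.
  suff -> : tau = tz by [].
  have sxz : same s x z := same_gtr s x.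
  have E : s (+) tau = s (+) tz.
    apply: (@same_eq _ _ (p x) (p z)).
    - by rewrite pne eq_sym -divg_eq1 mulgK gtr_neq1.
    - exact: Hx.
    - by rewrite sameC Hz // sameC.
  by move: E; case: (s); case: (tau); case: (tz).
have all x : forall i y, same i x y -> same (i (+) tau) (p x) (p y).
  move: x; apply: (gen_indl gen_ab) => // x; [exact: (step true) | exact: (step false)].
move=> i x y; apply/idP/idP; last exact: all.
move=> sp; have [-> | xy] := eqVneq x y; first exact: same_refl.
have /adjP[_ [k sk]] : Y x y by rewrite -pY; apply: adj_same sp; rewrite pne.
have := same_eq _ sp (all x k y sk); rewrite pne xy => /(_ isT) E.
by move: E sk; case: (i); case: (tau); case: (k).
Qed.

Lemma type_aut (p : {perm R}) tau :
  (forall i x y, same (i (+) tau) (p x) (p y) = same i x y) -> p \in graph_aut Y.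
Proof.
move=> ptau; apply/graph_autP=> x y; apply/adjP/adjP.
  rewrite (inj_eq perm_inj) => -[xy [i si]]; split=> //.
  by exists (i (+) tau); rewrite -ptau -addbA addbb addbF.
rewrite (inj_eq perm_inj) => -[xy [i si]]; split=> //.
by exists (i (+) tau); rewrite ptau.
Qed.

(** The automorphisms of the graph that keep each of the two families of triangles. *)
Definition type_group : {group {perm R}} :=
  (graph_aut (same true) :&: graph_aut (same false))%G.

Lemma type_groupP (p : {perm R}) :
  reflect (forall i x y, same i (p x) (p y) = same i x y) (p \in type_group).
Proof.
apply: (iffP setIP) => [[/graph_autP pa /graph_autP pb] [] // | H].
by split; apply/graph_autP; apply: H.
Qed.

Lemma type_group_sub : type_group \subset graph_aut Y.
Proof.
by apply/subsetP=> p /type_groupP H; apply: (@type_aut _ false) => i x y; rewrite addbF.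
Qed.

Definition trans (g : R) : {perm R} := actperm 'R g.

Lemma transE g x : trans g x = x * g.
Proof. by rewrite actpermE. Qed.

Lemma transM g h : trans (g * h) = trans g * trans h.
Proof. by rewrite -morphM ?inE. Qed.

Lemma trans_inj : injective trans.
Proof. by move=> g h /permP/(_ 1); rewrite !transE !mul1g. Qed.

Definition trans_group : {group {perm R}} := (actperm 'R @* [set: R])%G.

Lemma mem_trans g : trans g \in trans_group.
Proof. by apply: mem_morphim; rewrite ?inE. Qed.

Lemma trans_groupP p : reflect (exists g, p = trans g) (p \in trans_group).
Proof.
apply: (iffP morphimP) => [[g _ _ ->] | [g ->]]; first by exists g.
by exists g; rewrite ?inE.
Qed.

Lemma card_trans_group : #|trans_group| = #|R|.
Proof.
rewrite card_injm ?cardsT //; apply/injmP=> g h _ _; exact: trans_inj.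
Qed.

Lemma trans_type g : trans g \in type_group.
Proof. by apply/type_groupP=> i x y; rewrite !transE same_mul. Qed.

Lemma gen_trans : <<[set trans a; trans b]>> = trans_group.
Proof.
transitivity (actperm 'R @* <<[set a; b]>>); last by rewrite gen_ab.
rewrite morphim_gen ?subsetT //; congr <<_>>.
by rewrite morphimEsub ?subsetT // imsetU1 imset_set1.
Qed.

Definition type_stab : {group {perm R}} := 'C_type_group[1 | 'P]%G.

Lemma type_stabP p : reflect (p \in type_group /\ p 1 = 1) (p \in type_stab).
Proof.
by apply: (iffP setIP) => -[pG p1]; split=> //; [move/astab1P: p1 | apply/astab1P].
Qed.

Lemma same_third i x y z w : x != y -> x != z -> y != z -> x != w -> z != w ->
  same i x y -> same i x z -> same i x w -> w = y.
Proof.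
have rep u : same i x u -> [\/ u = x, u = gtr i * x | u = gtr i ^+ 2 * x].
  move=> /mem_gtr[] /(canRL (mulgKV _)) ->; rewrite ?mul1g.
  - exact: Or31.
  - exact: Or32.
  - exact: Or33.
move=> xy xz yz xw zw /rep[] Ey /rep[] Ez /rep[] Ew; subst y z w;
  by rewrite ?eqxx in xy xz yz xw zw *.
Qed.

(** An element of odd order fixing a vertex fixes the other two vertices of each of its
    triangles, so it is trivial. *)
Lemma type_stab_odd p : p \in type_group -> p 1 = 1 -> odd #[p] -> p = 1.
Proof.
move=> /type_groupP pG p1 podd.
have pne x y : (p x != p y) = (x != y) by rewrite (inj_eq perm_inj).
(* The order being odd, [p] is a power of its square. *)
have sq : p = (p ^+ 2) ^+ (#[p].+1)./2.
  by rewrite -expgM mul2n halfK /= podd subn0 expgS expg_order mulg1.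
have fix_sq x : p (p x) = x -> p x = x.
  move=> ppx; have ppx1 : (p ^+ 2) x = x by rewrite expg2 permM.
  rewrite sq; elim: (_./2) => [|m IH]; first by rewrite perm1.
  by rewrite expgS permM ppx1.
have step i x : p x = x -> p (gtr i * x) = gtr i * x.
  move=> px; set y := gtr i * x; have [// | py] := eqVneq (p y) y.
  have xy : x != y by rewrite eq_sym -divg_eq1 mulgK gtr_neq1.
  have sxy : same i x y := same_gtr i x.
  apply: fix_sq; apply: (@same_third i x y (p y)) => //.
  - by rewrite -{1}px pne.
  - by rewrite eq_sym.
  - by rewrite -{1}px -{1}px !pne.
  - by rewrite pne eq_sym.
  - by rewrite -{1}px pG.
  - by rewrite -{1}px -{1}px !pG.
apply/permP=> x; rewrite perm1; move: x; apply: (gen_indl gen_ab) => // x.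
  exact: (step true).
exact: (step false).
Qed.

Lemma type_stab_2group : 2.-group type_stab.
Proof.
apply/pgroupP=> r r_pr /Cauchy-/(_ r_pr)[p /type_stabP[pG p1] op].
have [-> // | r_odd] := even_prime r_pr.
have p_1 := type_stab_odd pG p1; rewrite op in p_1.
by have := prime_gt1 r_pr; rewrite -op p_1 // order1.
Qed.

Lemma card_type_group : #|type_group| = (#|trans_group| * #|type_stab|)%N.
Proof.
rewrite -(card_orbit_stab 'P type_group 1) card_trans_group; congr (_ * _)%N.
rewrite -cardsT; apply: eq_card => x; rewrite inE; apply/orbitP.
by exists (trans x); rewrite ?trans_type // /= apermE transE mul1g.
Qed.

(** The stabiliser of the triangle [<[gtr i]>], that is, of a vertex of the clique
    graph; [type_stab] is the stabiliser of an edge of that graph. *)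
Definition coset_stab i : {group {perm R}} := 'N_type_group(<[gtr i]> | 'P)%G.

Lemma same1 i x : same i 1 x = (x \in <[gtr i]>).
Proof. by rewrite /same /= invg1 mulg1. Qed.

Lemma coset_stabP i p :
  reflect (p \in type_group /\ p 1 \in <[gtr i]>) (p \in coset_stab i).
Proof.
apply: (iffP setIP) => -[pG p1]; split=> //.
  by rewrite -[p 1]apermE (astabs_act _ p1).
rewrite !inE /=; apply/subsetP=> x xi; rewrite inE apermE.
rewrite -same1; apply: (@same_trans i (p 1)); first by rewrite same1.
by move/type_groupP: pG => ->; rewrite same1.
Qed.

Lemma type_stab_sub i : type_stab \subset coset_stab i.
Proof.
by apply/subsetP=> p /type_stabP[pG p1]; apply/coset_stabP; rewrite p1.
Qed.

Lemma card_coset_stab i : #|coset_stab i| = (3 * #|type_stab|)%N.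
Proof.
rewrite -(card_orbit_stab 'P (coset_stab i) 1); congr (_ * _)%N.
  rewrite -(order_gtr i) orderE; apply: eq_card => x; apply/orbitP/idP.
    by case=> p /coset_stabP[_ p1] <-.
  move=> xi; exists (trans x); last by rewrite /= apermE transE mul1g.
  by apply/coset_stabP; rewrite trans_type transE mul1g.
congr #|pred_of_set _|; apply/setP=> p; apply/setIP/type_stabP.
  by case=> /coset_stabP[pG _] /astab1P.
case=> pG p1; split; last exact/astab1P.
by apply/coset_stabP; rewrite p1.
Qed.

Lemma order_trans i : #[trans (gtr i)] = 3.
Proof.
rewrite order_injm ?inE ?order_gtr //; apply/injmP=> g h _ _; exact: trans_inj.
Qed.

(** A subgroup that fixes 1 and is normalised by the transitive group of translations
    fixes every vertex. *)
Lemma trans_core_free (T : {group {perm R}}) :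
  T \subset type_stab -> trans_group \subset 'N(T) -> T :=: 1.
Proof.
move=> sTE nT; apply/trivgP/subsetP=> t Tt; rewrite inE; apply/eqP/permP=> x.
have: t ^ trans x^-1 \in T.
  by rewrite memJ_norm // (subsetP nT) ?mem_trans.
move/(subsetP sTE)/type_stabP=> [_]; rewrite conjgE.
rewrite (_ : (trans x^-1)^-1 = trans x); last first.
  by apply: mulg1_eq; rewrite -transM mulVg [trans 1]morph1.
by rewrite !permM !transE mul1g perm1 => /divg1_eq.
Qed.

(** * The full automorphism group *)

Hypothesis R3 : 3.-group [set: R].
Variable rot : {perm R}.
Hypotheses (rotA : rot \in Aut [set: R]) (rota : rot a = b) (rotb : rot b = a ^+ 2).

Lemma autM (p : {perm R}) : p \in Aut [set: R] -> {morph p : x y / x * y}.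
Proof. by rewrite inE => /andP[_ /morphicP pM] x y; rewrite pM ?inE. Qed.

Lemma trans_autJ (p : {perm R}) g : p \in Aut [set: R] -> trans g ^ p = trans (p g).
Proof.
move=> pA; rewrite conjgE; apply: (mulgI p); rewrite mulKVg.
by apply/permP=> x; rewrite !permM !transE (autM pA).
Qed.

Lemma rot_gtr i : <[rot (gtr i)]> = <[gtr (~~ i)]>.
Proof. by case: i; rewrite ?rota ?rotb //= sqr_cube1 // cycleV. Qed.

Lemma rot_same i x y : same (~~ i) (rot x) (rot y) = same i x y.
Proof.
have rM := autM rotA.
rewrite /same /= -(morph_groupV rM) -rM -rot_gtr.
apply/idP/idP=> /cycleP[k].
  by rewrite -(morph_groupX rM) => /perm_inj->; apply: mem_cycle.
by move->; rewrite (morph_groupX rM) mem_cycle.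
Qed.

Lemma rot_aut : rot \in graph_aut Y.
Proof. by apply: (@type_aut _ true) => i x y; rewrite addbT rot_same. Qed.

Lemma rot_norm_type : rot \in 'N(type_group).
Proof.
rewrite inE; apply/subsetP=> _ /imsetP[p /type_groupP pG ->].
apply/type_groupP=> i x y; rewrite conjgE !permM -[i]negbK rot_same pG.
by rewrite -rot_same !permKV.
Qed.

(** The stabilisers of the triangles [<[a]>] and [<[b]>] play the parts of [A] and [B]
    in the preceding criterion; [rot] normalises [type_group] and conjugates the
    translation by [a] into the translation by [b], which is the symmetry required. *)
Lemma trans_normal_type : trans_group <| type_group.
Proof.
suff <- : 'O_3(type_group) = trans_group by apply: pcore_normal.
have rot_pcore : rot \in 'N('O_3(type_group)).
  by rewrite (subsetP (char_norms (pcore_char _ _))) ?rot_norm_type.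
apply: (@pcore3_generated _ _ type_stab trans_group _ _ _ _ _ (coset_stab true)
  (coset_stab false) (trans a) (trans b)).
- exact: subsetIl.
- by rewrite -gen_trans gen_subG; apply/subsetP=> p /set2P[] ->; apply: trans_type.
- exact: type_stab_2group.
- exact: morphim_pgroup.
- exact: card_type_group.
- exact: subsetIl.
- exact: subsetIl.
- exact: type_stab_sub.
- exact: type_stab_sub.
- exact: card_coset_stab.
- exact: card_coset_stab.
- by apply/coset_stabP; rewrite trans_type transE mul1g (cycle_id a).
- exact: (order_trans true).
- by apply/coset_stabP; rewrite trans_type transE mul1g (cycle_id b).
- exact: (order_trans false).
- exact: gen_trans.
- exact: trans_core_free.
- by rewrite -rota -(trans_autJ _ rotA) memJ_norm.
Qed.

(** A permutation fixing 1 and normalising the translations is multiplicative. *)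
Lemma type_stab_aut p : p \in type_group -> p 1 = 1 -> p \in Aut [set: R].
Proof.
move=> pG p1; rewrite inE; apply/andP; split; first by apply/subsetP=> x; rewrite inE.
apply/morphicP=> x g _ _.
have: trans g ^ p \in trans_group.
  by rewrite memJ_norm ?mem_trans // (subsetP (normal_norm trans_normal_type)).
case/trans_groupP=> h E; have {}E : trans g * p = p * trans h by rewrite -E conjgC.
have:= E; move/permP/(_ 1); rewrite !permM !transE mul1g p1 mul1g => ->.
by have := E; move/permP/(_ x); rewrite !permM !transE.
Qed.

Hypothesis no_refl : forall phi : {perm R}, phi \in Aut [set: R] ->
  phi a = a -> phi b = b ^+ 2 -> False.

Lemma aut_eq (p p' : {perm R}) : p \in Aut [set: R] -> p' \in Aut [set: R] ->
  p a = p' a -> p b = p' b -> p = p'.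
Proof.
move=> pA pA' Ea Eb; apply/permP; apply: (gen_indl gen_ab) => [|x IH|x IH].
- by rewrite (morph_group1 (autM pA)) (morph_group1 (autM pA')).
- by rewrite (autM pA) (autM pA') Ea IH.
- by rewrite (autM pA) (autM pA') Eb IH.
Qed.

Lemma rot2_gtr i : (rot ^+ 2) (gtr i) = gtr i ^+ 2.
Proof.
have rX := morph_groupX (autM rotA).
by case: i; rewrite /= expg2 permM ?rota ?rotb ?rX ?rota.
Qed.

Lemma rotX_Aut k : rot ^+ k \in Aut [set: R].
Proof. exact: groupX. Qed.

Lemma rot2_type : rot ^+ 2 \in type_group.
Proof.
apply/type_groupP=> i x y; rewrite expg2 !permM.
by rewrite -(rot_same i x y) -(rot_same (~~ i) (rot x)) negbK.
Qed.

Lemma rot4 : rot ^+ 4 = 1.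
Proof.
have rot4_gtr i : (rot ^+ 4) (gtr i) = gtr i.
  rewrite (expgnDr _ 2 2) permM rot2_gtr (morph_groupX (autM (rotX_Aut 2))) rot2_gtr.
  by rewrite sqr_sqr_cube1 ?gtr3.
by apply: aut_eq; rewrite ?group1 ?rotX_Aut ?perm1 //; [apply: (rot4_gtr true) | apply: (rot4_gtr false)].
Qed.

Lemma order_rot : #[rot] = 4.
Proof.
have d4 : #[rot] %| 4 by rewrite order_dvdn rot4.
have nd2 : ~~ (#[rot] %| 2).
  rewrite order_dvdn; apply/eqP=> r2; have := rot2_gtr true; rewrite r2 perm1.
  by rewrite expg2 -[LHS]mulg1 => /mulgI/esym/eqP; rewrite (negPf (gtr_neq1 true)).
have := dvdn_leq (isT : 0 < 4) d4; move: d4 nd2.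
by case: #[rot] => [|[|[|[|[|]]]]].
Qed.

(** An automorphism preserving both families at 1 maps [a] to [a] or [a^2] and [b] to
    [b] or [b^2]; after composition with a power of [rot^2] it fixes [a], and the
    absence of reflections makes it trivial. *)
Lemma type_stab_rot p : p \in type_group -> p 1 = 1 -> exists k, p = rot ^+ (2 * k).
Proof.
move=> pG p1.
have fixa phi : phi \in type_group -> phi 1 = 1 -> phi a = a -> phi = 1.
  move=> phiG phi1 phia; have phiA := type_stab_aut phiG phi1.
  apply: aut_eq; rewrite ?group1 ?perm1 //.
  have: same false (phi 1) (phi b) by rewrite (type_groupP _ phiG) same1 cycle_id.
  rewrite phi1 same1 => /mem_gtr[] //= E; last by case: (no_refl phiA phia E).
  have: phi b = phi 1 by rewrite E phi1.
  by move/perm_inj=> /eqP; rewrite (negPf (gtr_neq1 false)).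
have: same true (p 1) (p a) by rewrite (type_groupP _ pG) same1 cycle_id.
rewrite p1 same1 => /mem_gtr[] /= E.
- have: p a = p 1 by rewrite E p1.
  by move/perm_inj=> /eqP; rewrite (negPf (gtr_neq1 true)).
- by exists 0; rewrite muln0; apply: fixa.
exists 1%N; apply: (mulIg (rot ^+ 2)); rewrite -expgnDr rot4.
apply: fixa; first by rewrite groupM ?rot2_type.
  by rewrite permM p1 (morph_group1 (autM (rotX_Aut 2))).
rewrite permM E (morph_groupX (autM (rotX_Aut 2))) (rot2_gtr true).
by rewrite sqr_sqr_cube1.
Qed.

(** A translation brings the image of 1 back to 1; if the result exchanges the two
    families, composing it with [rot] restores them. *)
Lemma aut_decomp p : p \in graph_aut Y -> exists k g, p = rot ^+ k * trans g.
Proof.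
move=> pY; set p' := p * trans (p 1)^-1.
have p'1 : p' 1 = 1 by rewrite permM transE mulgV.
suff [k E] : exists k, p' = rot ^+ k.
  exists k, (p 1); rewrite -E -mulgA -transM mulVg [trans 1]morph1 mulg1 //.
have p'Y : p' \in graph_aut Y.
  by rewrite groupM // (subsetP type_group_sub) ?trans_type.
have [[] tau] := aut_type p'Y; last first.
  have [|k E] := @type_stab_rot p' _ p'1; last by exists (2 * k)%N.
  by apply/type_groupP=> i x y; have := tau i x y; rewrite addbF.
have [||k E] := @type_stab_rot (p' * rot).
- apply/type_groupP=> i x y; have := tau i x y; rewrite addbT => <-.
  by rewrite !(permM p') -[i in LHS]negbK rot_same.
- by rewrite permM p'1 (morph_group1 (autM rotA)).
exists (2 * k + 3)%N; rewrite expgnDr -E -mulgA -expgS rot4 mulg1 //.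
Qed.

Lemma rotX_trans_aut k g : rot ^+ k * trans g \in graph_aut Y.
Proof. by rewrite groupM ?groupX ?rot_aut // (subsetP type_group_sub) ?trans_type. Qed.

Lemma trans_normal : trans_group <| graph_aut Y.
Proof.
apply/andP; split.
  by apply/subsetP=> _ /trans_groupP[g ->]; rewrite (subsetP type_group_sub) ?trans_type.
apply/subsetP=> _ /aut_decomp[k [g ->]]; apply: groupM; last first.
  by rewrite (subsetP (normG _)) ?mem_trans.
rewrite inE; apply/subsetP=> _ /imsetP[_ /trans_groupP[h ->] ->].
by rewrite trans_autJ ?rotX_Aut ?mem_trans.
Qed.

(** * Connected-set-homogeneity and 2-geodesics *)

Lemma conn_connection : connection_set conn.
Proof.
split; first by rewrite conn_mem eqxx.
apply/setP=> x; rewrite inE !conn_mem invg_eq1; congr (_ && _).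
by apply: eq_existsb => i; rewrite groupV.
Qed.

Lemma adjC x y : Y x y = Y y x.
Proof. exact: (cayley_sym conn_connection). Qed.

Lemma adj_irr x : Y x x = false.
Proof. exact: (cayley_irr conn_connection). Qed.

Lemma adj1 x : Y 1 x = (x \in conn).
Proof. by rewrite /cayley /= invg1 mulg1. Qed.

Lemma rotX1 k : (rot ^+ k) 1 = 1.
Proof. exact: morph_group1 (autM (rotX_Aut k)). Qed.

Lemma rot3_a : (rot ^+ 3) a = b ^+ 2.
Proof.
rewrite (expgSr rot 2) permM [_ a](rot2_gtr true).
by rewrite (morph_groupX (autM rotA)) rota.
Qed.

Lemma rot3_b : (rot ^+ 3) b = a.
Proof.
rewrite (expgSr rot 2) permM [_ b](rot2_gtr false).
by rewrite (morph_groupX (autM rotA)) rotb sqr_sqr_cube1.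
Qed.

Lemma aut_fix1 p : p \in graph_aut Y -> p 1 = 1 -> p \in <[rot]>.
Proof.
move=> pY; have [k [g ->]] := aut_decomp pY.
rewrite permM rotX1 transE mul1g => ->.
by rewrite [trans 1]morph1 mulg1 mem_cycle.
Qed.

Lemma cayley_aut_rot : cayley_aut conn = <[rot]>.
Proof.
apply/eqP; rewrite eqEsubset; apply/andP; split; last first.
  apply/subsetP=> _ /cycleP[k ->].
  rewrite cayley_autE inE rotX_Aut eqEcard card_imset ?leqnn ?andbT;
    last exact: perm_inj.
  apply/subsetP=> _ /imsetP[x xS ->]; rewrite -adj1 -(rotX1 k).
  by rewrite (graph_autP _ _ (groupX k rot_aut)) adj1.
apply/subsetP=> p; rewrite cayley_autE inE => /andP[pA /eqP pS].
have pM := autM pA; have pY : p \in graph_aut Y.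
  apply/graph_autP=> x y; rewrite /cayley /= -(morph_groupV pM) -pM -{1}pS.
  by rewrite mem_imset //; apply: perm_inj.
exact: aut_fix1 pY (morph_group1 pM).
Qed.

Lemma conn_rot s : s \in conn -> exists k, s = (rot ^+ k) a.
Proof.
have r2a : (rot ^+ 2) a = a ^+ 2 := rot2_gtr true.
rewrite !inE -!orbA => /or4P[] /eqP->.
- by exists 0; rewrite perm1.
- by exists 2%N; rewrite r2a.
- by exists 1%N; rewrite expg1.
- by exists 3%N; rewrite rot3_a.
Qed.

Lemma arc_transport x y : Y x y ->
  exists2 p : {perm R}, p \in graph_aut Y & p 1 = x /\ p a = y.
Proof.
rewrite /cayley /= => /conn_rot[k E]; exists (rot ^+ k * trans x).
  exact: rotX_trans_aut.
by rewrite !permM !transE rotX1 mul1g -E mulgVK.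
Qed.

Lemma triangle_transport x y z : x != y -> y != z -> Y x y -> Y x z -> Y y z ->
  exists2 p : {perm R}, p \in graph_aut Y & [/\ p 1 = x, p a = y & p (a ^+ 2) = z].
Proof.
move=> xy yz Yxy Yxz Yyz; have [p pY [p1 pa]] := arc_transport Yxy.
exists p => //; split=> //; have [tau ptau] := aut_type pY.
have sa : same true 1 a by rewrite same1 (cycle_id a).
have sa2 : same true 1 (a ^+ 2) by rewrite same1 (mem_cycle a).
have pne u v : (p u != p v) = (u != v) by rewrite (inj_eq perm_inj).
have a_1 : a != 1 := gtr_neq1 true.
have a2_1 : a ^+ 2 != 1 by rewrite sqr_cube1 // invg_eq1.
have a2_a : a ^+ 2 != a by rewrite expg2 -divg_eq1 mulgK.
have sxy : same (true (+) tau) x y by rewrite -p1 -pa ptau.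
apply: (@same_third (true (+) tau) x z y) => //.
- by apply/eqP=> xz; move: Yxz; rewrite xz adj_irr.
- by rewrite eq_sym.
- by rewrite -p1 pne eq_sym.
- by rewrite -pa pne eq_sym.
- exact: triangle_same Yyz.
- by rewrite -p1 ptau.
Qed.

Lemma nadj_ab : Y a b = false.
Proof.
apply/negP=> /adjP[_ [k sk]].
have sa : same true 1 a by rewrite same1 (cycle_id a).
have sb : same (~~ true) 1 b by rewrite same1 (cycle_id b).
have [/esym/eqP|/esym/eqP] := same_cross sa sb sk.
  by rewrite (negPf (gtr_neq1 true)).
by rewrite (negPf (gtr_neq1 false)).
Qed.

(** Up to an automorphism [y] is 1 and [x] is [a], so that [z] is [b] or [b^2]; in the
    second case [rot^3] maps the pair [(a, b)] to [(b^2, a)]. *)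
Lemma path_transport x y z : x != z -> Y y x -> Y y z -> ~~ Y x z ->
  exists2 p : {perm R}, p \in graph_aut Y & p 1 = y /\ [set p a; p b] = [set x; z].
Proof.
move=> xz Yyx Yyz nYxz; have [p pY [p1 pa]] := arc_transport Yyx.
have [w pw] : exists w, p w = z by exists (p^-1 z); rewrite permKV.
have pE := graph_autP _ _ pY.
have: w \in conn by rewrite -adj1 -pE p1 pw.
rewrite !inE -!orbA => /or4P[] /eqP wE; subst w.
- by case/eqP: xz; rewrite -pa -pw.
- case/negP: nYxz; rewrite -pa -pw pE; apply: (@adj_same true).
    by rewrite eq_sym expg2 -divg_eq1 mulgK (gtr_neq1 true).
  by rewrite /same /= expg2 mulgK (cycle_id a).
- by exists p => //; rewrite pa pw.
exists (rot ^+ 3 * p); first by rewrite groupM ?groupX ?rot_aut.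
by rewrite !(permM (rot ^+ 3)) rotX1 rot3_a rot3_b p1 pa pw setUC.
Qed.

Lemma connected_neighbor (A : {set R}) x w : induced_connected Y A ->
  x \in A -> w \in A -> x != w -> exists2 u, u \in A & Y x u.
Proof.
move=> cA xA wA xw; have /connectP[[|u s] /= ] := cA x w xA wA.
  by move=> _ E; rewrite E eqxx in xw.
by case/andP=> /and3P[_ uA xu] _ _; exists u.
Qed.

(** Connected sets of at most three vertices fall under five shapes, each a single
    orbit, and the number of vertices together with completeness tells them apart. *)
Definition shapes : seq {set R} :=
  [:: set0; [set 1]; [set 1; a]; [set 1; a; a ^+ 2]; [set 1; a; b]].

Lemma connected_shape (A : {set R}) : #|A| <= 3 -> induced_connected Y A ->
  exists2 p : {perm R}, p \in graph_aut Y & exists2 C, C \in shapes & A = p @: C.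
Proof.
move=> A3 cA.
have mem k : nth set0 shapes k \in shapes.
  have [ks | ks] := ltnP k (size shapes); first exact: mem_nth.
  by rewrite nth_default // !inE eqxx.
have [-> | [x xA]] := set_0Vmem A.
  by exists 1; rewrite ?group1 //; exists set0; rewrite ?imset0 ?(mem 0).
have [Ax | /forall_inPn[y yA yx]] := boolP [forall y in A, y == x].
  exists (trans x); first by rewrite (subsetP type_group_sub) ?trans_type.
  exists [set 1]; first exact: (mem 1%N).
  rewrite imset_set1 transE mul1g; apply/setP=> y; rewrite inE.
  by apply/idP/eqP=> [yA | -> //]; apply/eqP/(forall_inP Ax).
have [|u uA xu] := connected_neighbor cA xA yA; first by rewrite eq_sym.
have x_u : x != u by apply/eqP=> E; rewrite E adj_irr in xu.
have [A2 | [z]] := set_0Vmem (A :\: [set x; u]).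
  have [p pY [p1 pa]] := arc_transport xu; exists p => //.
  exists [set 1; a]; first exact: (mem 2%N).
  rewrite imsetU !imset_set1 p1 pa; apply/eqP; rewrite eqEsubset -setD_eq0 A2 eqxx.
  by apply/subsetP=> v /set2P[] ->.
rewrite !inE negb_or -andbA => /and3P[zx zu zA].
have defA : A = [set x; u; z].
  have c3 : #|[set x; u; z]| = 3.
    by rewrite setUC cardsU1 !inE negb_or zx zu cards2 x_u.
  apply/esym/eqP; rewrite eqEcard c3 A3 andbT.
  by apply/subsetP=> v; rewrite !inE -orbA => /or3P[] /eqP->.
have [w wA zw] := connected_neighbor cA zA xA zx.
have wE : (w == x) || (w == u).
  move: wA zw; rewrite defA !inE => /orP[-> // | /eqP->]; by rewrite adj_irr.
have [Yzx | nYzx] := boolP (Y z x); have [Yzu | nYzu] := boolP (Y z u).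
- have [|||p pY [p1 pa pa2]] := @triangle_transport x u z x_u _ xu _ _.
  + by rewrite eq_sym.
  + by rewrite adjC.
  + by rewrite adjC.
  exists p => //; exists [set 1; a; a ^+ 2]; first exact: (mem 3%N).
  by rewrite !imsetU !imset_set1 p1 pa pa2.
- have [|||p pY [p1 pab]] := @path_transport u x z _ xu _ _.
  + by rewrite eq_sym.
  + by rewrite adjC.
  + by rewrite adjC.
  exists p => //; exists [set 1; a; b]; first exact: (mem 4%N).
  by rewrite -setUA !imsetU !imset_set1 p1 pab defA setUA.
- have [||||p pY [p1 pab]] := @path_transport x u z _ _ _ _.
  + by rewrite eq_sym.
  + by rewrite adjC.
  + by rewrite adjC.
  + by rewrite adjC.
  exists p => //; exists [set 1; a; b]; first exact: (mem 4%N).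
  by rewrite -setUA !imsetU !imset_set1 p1 pab defA setUA [[set u] :|: _]setUC.
- by case/orP: wE zw => /eqP->; rewrite ?(negPf nYzx) ?(negPf nYzu).
Qed.

Lemma is_clique_imset (p : {perm R}) (A : {set R}) : p \in graph_aut Y ->
  is_clique Y (p @: A) = is_clique Y A.
Proof.
move/graph_autP=> pE; apply/forall_inP/forall_inP=> cl x xA; apply/forall_inP=> y yA.
  have := forall_inP (cl _ (imset_f p xA)) _ (imset_f p yA).
  by rewrite pE (inj_eq perm_inj).
case/imsetP: xA => u uA ->; case/imsetP: yA => v vA ->.
by rewrite pE (inj_eq perm_inj); apply: (forall_inP (cl u uA)).
Qed.

Lemma shapes_inj C D : C \in shapes -> D \in shapes ->
  #|C| = #|D| -> is_clique Y C = is_clique Y D -> C = D.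
Proof.
have a_1 : 1 != a by rewrite eq_sym (gtr_neq1 true).
have b_1 : 1 != b by rewrite eq_sym (gtr_neq1 false).
have a_b : a != b.
  apply/eqP=> E; case/eqP: a_1; apply/esym; apply: (@gtr_TI true); rewrite /=.
    exact: cycle_id.
  by rewrite E cycle_id.
have a2_a : a != a ^+ 2 by rewrite eq_sym expg2 -divg_eq1 mulgK eq_sym.
have a2_1 : 1 != a ^+ 2 by rewrite sqr_cube1 // eq_sym invg_eq1 eq_sym.
have c2 : #|[set 1; a]| = 2 by rewrite cards2 a_1.
have c3 : #|[set 1; a; a ^+ 2]| = 3.
  by rewrite setUC cardsU1 c2 !inE negb_or eq_sym a2_1 eq_sym a2_a.
have c3' : #|[set 1; a; b]| = 3.
  by rewrite setUC cardsU1 c2 !inE negb_or eq_sym b_1 eq_sym a_b.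
have q3 : is_clique Y [set 1; a; a ^+ 2].
  apply/forall_inP=> x xA; apply/forall_inP=> y yA; apply/implyP=> xy.
  apply: (@adj_same true) => //.
  have mem_a z : z \in [set 1; a; a ^+ 2] -> z \in <[a]>.
    by rewrite !inE -orbA => /or3P[] /eqP->; rewrite ?group1 ?cycle_id ?mem_cycle.
  by rewrite /same /= groupM ?groupV ?mem_a.
have q3' : ~~ is_clique Y [set 1; a; b].
  apply/negP=> /forall_inP/(_ a)/[!inE]/[!eqxx]/[!orbT]/(_ isT)/forall_inP/(_ b).
  by rewrite !inE eqxx orbT a_b nadj_ab => /(_ isT).
have NE (A B : {set R}) : #|A| != #|B| -> #|A| = #|B| -> A = B by move=> /eqP.
rewrite !inE => /or4P[|||/orP[]] /eqP-> /or4P[|||/orP[]] /eqP-> //;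
  rewrite ?c2 ?c3 ?c3' ?cards0 ?cards1 // => _; by rewrite q3 (negPf q3').
Qed.

Lemma conn_CSH3 : CSH3 Y.
Proof.
move=> A B A3 B3 cA cB [f [f_inj fA f_adj]].
have [p pY [C Cs defA]] := connected_shape A3 cA.
have [p' p'Y [D Ds defB]] := connected_shape B3 cB.
suff CD : C = D.
  exists (p^-1 * p'); first by rewrite groupM ?groupV.
  rewrite defA defB CD -imset_comp; apply: eq_imset => x /=.
  by rewrite permM permK.
apply: shapes_inj => //.
  rewrite -(card_imset (mem C) (@perm_inj _ p)) -(card_imset (mem D) (@perm_inj _ p')).
  by rewrite -defA -defB -fA card_in_imset.
rewrite -(is_clique_imset C pY) -(is_clique_imset D p'Y) -defA -defB -fA.
apply/forall_inP/forall_inP=> cl x xA; apply/forall_inP=> y yA.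
  case/imsetP: xA => u uA ->; case/imsetP: yA => v vA ->.
  have := forall_inP (cl u uA) v vA; rewrite f_adj //.
  by rewrite (inj_in_eq f_inj).
have := forall_inP (cl _ (imset_f f xA)) _ (imset_f f yA); rewrite f_adj //.
by rewrite (inj_in_eq f_inj).
Qed.

(** No automorphism reverses the 2-geodesic [(a, 1, b)]: composed with [rot^3] it would
    fix [a] and map [b] to [b^2]. *)
Lemma conn_not_geodesic2_transitive : ~ geodesic2_transitive Y.
Proof.
have Y1 i : Y 1 (gtr i).
  by apply: (@adj_same i); rewrite ?same1 ?cycle_id // eq_sym gtr_neq1.
have [Ya Yb] : Y 1 a /\ Y 1 b by split; [apply: (Y1 true) | apply: (Y1 false)].
have a_b : a != b.
  apply/eqP=> E; case/eqP: (gtr_neq1 true); apply: (@gtr_TI true); rewrite /=.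
    exact: cycle_id.
  by rewrite E cycle_id.
have geod x y : x != y -> Y 1 x -> Y 1 y -> Y x y = false -> geodesic2 Y x 1 y.
  move=> xy Yx Yy nYxy; split=> //; first by rewrite adjC.
  split; first by exists [:: 1; y]; rewrite /= adjC Yx Yy.
  case=> [_ /= E | z [|//]]; first by rewrite E eqxx in xy.
  by rewrite /= andbT => Yxz zy; rewrite -zy Yxz in nYxy.
case=> _ _ /(_ a 1 b b 1 a)[||p pY [pa p1 pb]].
- exact: geod nadj_ab.
- by apply: geod => //; rewrite 1?eq_sym // adjC nadj_ab.
have pA : p \in Aut [set: R].
  by apply: (subsetP _ _ (aut_fix1 pY p1)); rewrite cycle_subG.
apply: (no_refl (phi := p * rot ^+ 3)); first by rewrite groupM ?rotX_Aut.
  by rewrite permM pa rot3_b.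
by rewrite permM pb rot3_a.
Qed.

(** * The clique graph *)

Notation clique := (max_clique Y).
Notation C := (clique_graph Y).

Definition tri i x : {set R} := [set y | same i x y].

Lemma clique_sub_tri (K : {set R}) i x y : is_clique Y K ->
  x \in K -> y \in K -> x != y -> same i x y -> K \subset tri i x.
Proof.
move=> /forall_inP clK xK yK xy sxy; apply/subsetP=> z zK; rewrite inE.
have [<- | xz] := eqVneq x z; first exact: same_refl.
have [<- // | yz] := eqVneq y z.
have Yxz : Y x z by apply: (implyP (forall_inP (clK x xK) z zK)).
have Yyz : Y y z by apply: (implyP (forall_inP (clK y yK) z zK)).
exact: triangle_same Yyz.
Qed.

Lemma tri_clique i x : is_clique Y (tri i x).
Proof.
apply/forall_inP=> y; rewrite inE => xy; apply/forall_inP=> z; rewrite inE => xz.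
apply/implyP=> yz; apply: (adj_same (i := i)) => //.
by apply: same_trans xz; rewrite sameC.
Qed.

Lemma tri_max i x : maxset (is_clique Y) (tri i x).
Proof.
apply/maxsetP; split=> [|K clK sK]; first exact: tri_clique.
apply/eqP; rewrite eqEsubset sK andbT; apply: (clique_sub_tri (y := gtr i * x)) => //.
- by rewrite (subsetP sK) // inE same_refl.
- by rewrite (subsetP sK) // inE same_gtr.
- by rewrite eq_sym -divg_eq1 mulgK gtr_neq1.
- exact: same_gtr.
Qed.

Definition mclique i x : clique := Sub (tri i x) (tri_max i x).

Lemma mcliqueP (K : clique) : exists i x, K = mclique i x.
Proof.
have [clK maxK] := maxsetP (valP K).
have [K0 | [x xK]] := set_0Vmem (val K).
  exists true, 1; apply: val_inj; apply/esym/maxK; rewrite ?tri_clique //.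
  by rewrite K0 sub0set.
have [Kx | /forall_inPn[y yK yx]] := boolP [forall y in val K, y == x].
  exists true, x; apply: val_inj; apply/esym/maxK; rewrite ?tri_clique //.
  by apply/subsetP=> y /(forall_inP Kx)/eqP->; rewrite inE same_refl.
have xy : x != y by rewrite eq_sym.
have /adjP[_ [i sxy]] : Y x y by apply: (implyP (forall_inP (forall_inP clK x xK) y yK)).
exists i, x; apply: val_inj; apply/esym/maxK; first exact: tri_clique.
exact: clique_sub_tri sxy.
Qed.

Lemma mclique_eq i j x y : (mclique i x == mclique j y) = (i == j) && same i x y.
Proof.
rewrite -val_eqE /=; apply/eqP/andP=> [E | [/eqP <- sxy]].
  have inj_tri z : same i x z -> same j y z.
    move=> xz; have : z \in tri i x by rewrite inE.
    by rewrite E inE.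
  have sx := inj_tri x (same_refl i x); have sx' := inj_tri _ (same_gtr i x).
  have ij : i = j.
    apply: (@same_eq _ _ x (gtr i * x)); last by rewrite (same_trans _ sx') 1?sameC.
      by rewrite eq_sym -divg_eq1 mulgK gtr_neq1.
    exact: same_gtr.
  by rewrite ij eqxx sameC.
apply/setP=> z; rewrite !inE.
by apply/idP/idP; apply: same_trans; rewrite // sameC.
Qed.

Lemma cliqueP K L : reflect (exists i z, K = mclique i z /\ L = mclique (~~ i) z) (C K L).
Proof.
apply: (iffP idP); have [i [x ->]] := mcliqueP K; have [j [y ->]] := mcliqueP L;
  rewrite /clique_graph /= mclique_eq.
- case/andP=> ne /set0Pn[z].
  rewrite !inE => /andP[xz yz]; exists i, z; split; apply/eqP; rewrite mclique_eq.
    by rewrite eqxx.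
  rewrite yz andbT; case: (eqVneq i j) ne => [ij | ]; last by case: (i); case: (j).
  by move/negP; case; apply: same_trans xz _; rewrite sameC ij.
case=> k [z [/eqP]]; rewrite mclique_eq => /andP[/eqP-> xz] /eqP; rewrite mclique_eq.
case/andP=> /eqP-> yz; apply/andP; split; first by case: (k).
by apply/set0Pn; exists z; rewrite !inE xz yz.
Qed.

Lemma mclique_adj i x : C (mclique i x) (mclique (~~ i) x).
Proof. by apply/cliqueP; exists i, x. Qed.

Lemma card_tri i x : #|tri i x| = 3.
Proof.
rewrite -(order_gtr i) orderE -(card_imset (mem <[gtr i]>) (mulIg x)); apply: eq_card => y.
rewrite inE /same /=; apply/idP/imsetP=> [yx | [g gi ->]]; last by rewrite mulgK.
by exists (y * x^-1); rewrite // mulgVK.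
Qed.

Lemma clique_trivalent : trivalent C.
Proof.
move=> K; have [i [x ->]] := mcliqueP K.
rewrite -(card_tri i x) -(card_in_imset (f := mclique (~~ i)) (D := tri i x)).
  apply: eq_card => L; rewrite inE; apply/cliqueP/imsetP.
    case=> j [z [/eqP]]; rewrite mclique_eq => /andP[/eqP-> xz] ->.
    by exists z; rewrite // inE -?ij.
  case=> z; rewrite inE => xz ->; exists i, z; split=> //.
  by apply/eqP; rewrite mclique_eq eqxx.
move=> y z; rewrite !inE => xy xz /eqP; rewrite mclique_eq eqxx /= => yz.
by apply: same_TI yz; apply: same_trans xz; rewrite sameC.
Qed.

(** Obtained by restriction from the action on sets, which makes the passage from
    automorphisms of the graph to automorphisms of its clique graph multiplicative. *)
Definition clique_action := subaction clique ('P^*)%act.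
Definition theta (p : {perm R}) : {perm clique} := actperm clique_action p.

Lemma imset_tri (p : {perm R}) tau i x :
  (forall i x y, same (i (+) tau) (p x) (p y) = same i x y) ->
  p @: tri i x = tri (i (+) tau) (p x).
Proof.
move=> ptau; apply/setP=> y; rewrite inE.
by rewrite -[y](permKV p) mem_imset ?inE ?ptau //; apply: perm_inj.
Qed.

Lemma aut_subact_dom p : p \in graph_aut Y ->
  p \in subact_dom (maxset (is_clique Y)) ('P^*)%act.
Proof.
move=> pY; rewrite inE; apply/andP; split=> //.
have [tau ptau] := aut_type pY.
rewrite inE; apply/subsetP=> K; rewrite !inE => maxK.
have [i [x]] := mcliqueP (Sub K maxK); move/(congr1 val); rewrite /= => ->.
rewrite /setact (eq_imset (g := p)); last by move=> y; rewrite /= apermE.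
by rewrite (imset_tri _ _ ptau) tri_max.
Qed.

Lemma thetaE (p : {perm R}) tau i x :
  (forall i x y, same (i (+) tau) (p x) (p y) = same i x y) ->
  theta p (mclique i x) = mclique (i (+) tau) (p x).
Proof.
move=> ptau; have pY := type_aut ptau; apply: val_inj.
rewrite /theta actpermE /= val_subact (aut_subact_dom pY) /= -(imset_tri _ _ ptau).
by apply: eq_imset => y; rewrite /= apermE.
Qed.

Lemma thetaM p p' : p \in graph_aut Y -> p' \in graph_aut Y ->
  theta (p * p') = theta p * theta p'.
Proof. by move=> pY pY'; rewrite /theta morphM ?aut_subact_dom. Qed.

Lemma thetaX p k : p \in graph_aut Y -> theta (p ^+ k) = theta p ^+ k.
Proof. by move=> pY; rewrite /theta morphX ?aut_subact_dom. Qed.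

Lemma theta_aut p : p \in graph_aut Y -> theta p \in graph_aut C.
Proof.
move=> pY; have [tau ptau] := aut_type pY.
apply/graph_autP=> K L; apply/cliqueP/cliqueP; last first.
  case=> i [x [-> ->]]; exists (i (+) tau), (p x).
  by rewrite !(thetaE _ _ ptau) addNb.
case=> i [x [EK EL]]; exists (i (+) tau), (p^-1 x); split;
  apply: (@perm_inj _ (theta p)); rewrite ?EK ?EL (thetaE _ _ ptau) permKV.
  by rewrite -addbA addbb addbF.
by rewrite -addNb -addbA addbb addbF.
Qed.

Lemma theta_inj : {in graph_aut Y &, injective theta}.
Proof.
move=> p p' pY pY' E; have [tau ptau] := aut_type pY.
have [tau' ptau'] := aut_type pY'; apply/permP=> x.
have mcE i : mclique (i (+) tau) (p x) = mclique (i (+) tau') (p' x).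
  by rewrite -(thetaE _ _ ptau) -(thetaE _ _ ptau') E.
have /eqP := mcE true; have /eqP := mcE false; rewrite !mclique_eq.
case/andP=> /eqP tt s0 /andP[_ s1]; apply: same_TI s0 _.
by move: s1; rewrite !addTb !addFb.
Qed.

(** The vertices of the Cayley graph are the edges of its clique graph, two of them
    being adjacent when they share an end; hence every automorphism of the clique graph
    comes from one of the Cayley graph. *)
Lemma theta_onto phi : phi \in graph_aut C ->
  exists2 p, p \in graph_aut Y & phi = theta p.
Proof.
move=> /graph_autP phiE.
have ex x : exists z, [exists i, (phi (mclique true x) == mclique i z) &&
                                 (phi (mclique false x) == mclique (~~ i) z)].
  have /cliqueP[i [z [E1 E2]]] : C (phi (mclique true x)) (phi (mclique false x)).
    by rewrite phiE (mclique_adj true).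
  by exists z; apply/existsP; exists i; rewrite E1 E2 !eqxx.
pose f x := xchoose (ex x).
have fE x : exists i, forall j, phi (mclique j x) = mclique (~~ (i (+) j)) (f x).
  have /existsP[i /andP[/eqP E1 /eqP E2]] := xchooseP (ex x); exists i.
  by case; rewrite ?E1 ?E2 ?addbT ?negbK ?addbF.
have f_ex x k : exists j, phi (mclique j x) = mclique k (f x).
  have [i Ei] := fE x; exists (~~ (i (+) k)); rewrite Ei; congr mclique.
  by case: (i); case: (k).
have f_same k x y : same k (f x) (f y) -> exists j,
    [/\ phi (mclique j x) = mclique k (f x), phi (mclique j y) = mclique k (f y) & same j x y].
  have [j Ej] := f_ex x k; have [l El] := f_ex y k => sk.
  have /eqP : phi (mclique j x) = phi (mclique l y).
    by rewrite Ej El; apply/eqP; rewrite mclique_eq eqxx.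
  rewrite (inj_eq perm_inj) mclique_eq => /andP[/eqP jl sxy].
  by exists j; split; [exact: Ej | rewrite jl; exact: El | exact: sxy].
have f_inj : injective f.
  move=> x y xy; have sxy k : same k (f x) (f y) by rewrite xy same_refl.
  have [j [Ej _ sj]] := f_same _ _ _ (sxy true).
  have [l [El _ sl]] := f_same _ _ _ (sxy false).
  have jl : j != l.
    apply/eqP=> jl; have: mclique true (f x) = mclique false (f x) by rewrite -Ej -El jl.
    by move/eqP; rewrite mclique_eq.
  by apply: (same_TI sj); move: jl sl; case: (j); case: (l).
have f_mc j x y : same j x y -> exists k,
    [/\ phi (mclique j x) = mclique k (f x), phi (mclique j y) = mclique k (f y) & same k (f x) (f y)].
  move=> sxy; have [i Ei] := fE x; have [l El] := fE y.
  have /eqP : phi (mclique j x) = phi (mclique j y).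
    by congr (phi _); apply/eqP; rewrite mclique_eq eqxx.
  rewrite Ei El mclique_eq => /andP[/eqP il sf].
  exists (~~ (i (+) j)); split; [by [] | by rewrite il | exact: sf].
pose p := perm f_inj.
have pY : p \in graph_aut Y.
  apply/graph_autP=> x y; rewrite !permE; apply/adjP/adjP=> -[xy [k sk]].
    split; first by rewrite -(inj_eq f_inj).
    by have [j [_ _ sj]] := f_same _ _ _ sk; exists j.
  split; first by rewrite (inj_eq f_inj).
  by have [j [_ _ sj]] := f_mc _ _ _ sk; exists j.
exists p => //; have [tau ptau] := aut_type pY.
apply/permP=> K; have [j [x ->]] := mcliqueP K; rewrite (thetaE _ _ ptau) permE.
have [k [-> _ sk]] := f_mc _ _ _ (same_gtr j x).
congr mclique; apply: (same_eq _ sk); last first.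
  by have := ptau j x (gtr j * x); rewrite !permE same_gtr.
by rewrite (inj_eq f_inj) eq_sym -divg_eq1 mulgK gtr_neq1.
Qed.

Lemma trans_same g i x y : same (i (+) false) (trans g x) (trans g y) = same i x y.
Proof. by rewrite !transE same_mul addbF. Qed.

Lemma rotX_same k i x y :
  same (i (+) odd k) ((rot ^+ k) x) ((rot ^+ k) y) = same i x y.
Proof.
elim: k => [|k IH]; first by rewrite !perm1 addbF.
by rewrite -IH expgSr !(permM (rot ^+ k)) /= addbN rot_same.
Qed.

Lemma theta_decomp phi : phi \in graph_aut C -> exists k g,
  phi = theta rot ^+ k * theta (trans g) /\
  forall i x, phi (mclique i x) = mclique (i (+) odd k) ((rot ^+ k) x * g).
Proof.
case/theta_onto=> p /aut_decomp[k [g ->]] ->; exists k, g.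
have rY := rot_aut; have tY := subsetP type_group_sub _ (trans_type g).
rewrite thetaM ?groupX ?thetaX //; split=> // i x.
rewrite permM -thetaX // (thetaE _ _ (rotX_same k)) (thetaE _ _ (trans_same g)).
by rewrite addbF transE.
Qed.

Lemma theta_rotX_trans k g i x :
  theta (rot ^+ k * trans g) (mclique i x) = mclique (i (+) odd k) ((rot ^+ k) x * g).
Proof.
have rY := rot_aut; have tY := subsetP type_group_sub _ (trans_type g).
rewrite thetaM ?groupX // permM (thetaE _ _ (rotX_same k)) (thetaE _ _ (trans_same g)).
by rewrite addbF transE.
Qed.

Lemma clique_arc_transitive : arc_transitive C.
Proof.
move=> K L K' L' /cliqueP[i [z [-> ->]]] /cliqueP[j [w [-> ->]]].
have tY g := subsetP type_group_sub _ (trans_type g).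
exists (theta (trans z^-1 * (rot ^+ (i != j) * trans w))).
  by rewrite theta_aut // !groupM ?groupX ?rot_aut.
rewrite thetaM ?groupM ?groupX ?rot_aut // !permM.
rewrite !(thetaE _ _ (trans_same _)) !theta_rotX_trans !transE mulgV rotX1 mul1g.
by case: (i); case: (j).
Qed.

Lemma order_theta p : p \in graph_aut Y -> #[theta p] = #[p].
Proof.
move=> pY; have th1 : theta 1 = 1 by apply: morph1.
apply/eqP; rewrite eqn_dvd !order_dvdn -thetaX // expg_order th1 eqxx /=.
apply/eqP/theta_inj; rewrite ?groupX ?group1 //.
by rewrite thetaX // expg_order th1.
Qed.

(** A power of [rot] times the translation by [g] fixes the triangle [<[a]>] exactly when
    the exponent is even and [g] is in [<[a]>]. *)
Lemma clique_vertex_stab :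
  'C_(graph_aut C)[mclique true 1 | 'P] =
  <<[set theta (trans a); theta (rot ^+ 2)]>>.
Proof.
have rY := rot_aut; have tY g := subsetP type_group_sub _ (trans_type g).
apply/eqP; rewrite eqEsubset gen_subG; apply/andP; split; apply/subsetP=> phi.
  case/setIP=> /theta_decomp[k [g [-> phiE]]] /astab1P; rewrite /= apermE phiE.
  rewrite rotX1 mul1g => /esym/eqP; rewrite mclique_eq same1 => /andP[/eqP k2].
  case/cycleP=> m ->; rewrite groupM //.
    have -> : k = (2 * k./2)%N.
      by rewrite mul2n -{1}(odd_double_half k); move: k2; case: (odd k).
    by rewrite expgM -thetaX // groupX // mem_gen // !inE eqxx orbT.
  have -> : theta (trans (gtr true ^+ m)) = theta (trans a) ^+ m.
    by rewrite -thetaX // /trans morphX ?inE.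
  by rewrite groupX // mem_gen // !inE eqxx.
case/set2P=> ->; apply/setIP; split; rewrite ?theta_aut ?groupX //; apply/astab1P;
  rewrite /= apermE.
- rewrite (thetaE _ _ (trans_same a)) transE mul1g; apply/eqP.
  by rewrite mclique_eq eqxx sameC same1 (cycle_id a).
- by rewrite (thetaE _ _ (rotX_same 2)) rotX1.
Qed.

(** The two ends of the edge meet in the vertex 1 only, so their joint stabiliser is that
    of 1. *)
Lemma clique_edge_stab :
  'N_(graph_aut C)([set mclique true 1; mclique false 1] | 'P) = <[theta rot]>.
Proof.
have rY := rot_aut; have tY g := subsetP type_group_sub _ (trans_type g).
apply/eqP; rewrite eqEsubset; apply/andP; split; apply/subsetP=> phi; last first.
  case/cycleP=> k ->; rewrite -thetaX //; apply/setIP; split.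
    by rewrite theta_aut ?groupX.
  rewrite !inE /=; apply/subsetP=> K KS; rewrite inE apermE.
  have [i ->] : exists i, K = mclique i 1.
    by case/set2P: KS => ->; [exists true | exists false].
  rewrite (thetaE _ _ (rotX_same k)) rotX1 !inE.
  by case: (i (+) odd k); rewrite eqxx ?orbT.
case/setIP=> /theta_decomp[k [g [-> phiE]]] phiS.
have g_in i : exists j, mclique (i (+) odd k) g = mclique j 1.
  have := astabs_act (mclique i 1) phiS; rewrite /= apermE phiE rotX1 mul1g.
  have -> : mclique i 1 \in [set mclique true 1; mclique false 1].
    by rewrite !inE; case: i; rewrite eqxx ?orbT.
  by case/set2P=> ->; [exists true | exists false].
have sg i : same i 1 g.
  have [j /eqP] := g_in (i (+) odd k).
  by rewrite -addbA addbb addbF mclique_eq sameC => /andP[].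
have -> : g = 1 by apply/esym/(same_TI (sg true) (sg false)).
have -> : theta (trans 1) = 1 by rewrite [trans 1]morph1; apply: morph1.
by rewrite mulg1 mem_cycle.
Qed.

Lemma clique_type2_2 : type2_2 C.
Proof.
have rY := rot_aut; have tY g := subsetP type_group_sub _ (trans_type g).
exists (mclique true 1), (mclique false 1); split; first exact: (mclique_adj true).
  rewrite clique_vertex_stab; apply: isog_S3.
  - by rewrite order_theta ?(order_trans true).
  - rewrite order_theta ?groupX // orderXdiv order_rot //.
  have -> : theta (trans a) ^ theta (rot ^+ 2) = theta (trans a ^ rot ^+ 2).
    by rewrite /theta morphJ ?aut_subact_dom ?groupX.
  rewrite (trans_autJ _ (rotX_Aut 2)) [_ a](rot2_gtr true) sqr_cube1 ?gtr3 //.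
  rewrite /trans morphV ?inE //; apply: morphV; exact: aut_subact_dom.
rewrite clique_edge_stab; apply: isog_Z4.
by rewrite order_theta // order_rot.
Qed.

End CayleyGraph.

Theorem lemma6p8 (n : nat) (hn : (2 <= n)%N) :
  (exists (R : finGroupType) (a b : R), presented n a b) /\
  (forall (R : finGroupType) (a b : R), presented n a b ->
     let S := [set a; a ^+ 2; b; b ^+ 2] in
     let Y := cayley S in
     let C := clique_graph Y in
     #|R| = (3 ^ (4 * n + 1))%N /\
     [/\ connection_set S, normal_cayley S & cayley_aut S \isog [set: 'Z_4]] /\
     CSH3 Y /\ ~ geodesic2_transitive Y /\
     [/\ trivalent C, arc_transitive C & type2_2 C]).
Proof.
split.
  by have [R [a [b [pres _]]]] := presented_exists hn; exists R, a, b.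
move=> R a b pres S Y C.
have a3 := presented_cube_a pres; have b3 := presented_cube_b pres.
have gen : <<[set a; b]>> = [set: R] by case: pres.
have indep := presented_cycles_indep hn pres.
have cardR := presented_card hn pres.
have R3 : 3.-group [set: R] by rewrite /pgroup cardsT cardR pnatX pnat_id.
have [rot rotA [rota rotb]] := presented_rotation hn pres.
have noref := presented_no_reflection hn pres.
split=> //; split; last split.
- split.
  + exact: (conn_connection a3 b3 indep).
  + exact: (trans_normal a3 b3 gen indep R3 rotA rota rotb noref).
  + rewrite [cayley_aut S](cayley_aut_rot a3 b3 gen indep R3 rotA rota rotb noref).
    by apply: isog_Z4; apply: (order_rot a3 b3 gen indep rotA rota rotb).
- exact: (conn_CSH3 a3 b3 gen indep rotA rota rotb).
split; first exact: (conn_not_geodesic2_transitive a3 b3 gen indep R3 rotA rota rotb noref).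
split.
- exact: (clique_trivalent a3 b3 indep).
- exact: (clique_arc_transitive a3 b3 gen indep rotA rota rotb).
- exact: (clique_type2_2 a3 b3 gen indep R3 rotA rota rotb noref).
Qed.
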